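(* Let $H=\langle a_1,a_2,\dots,a_\ell\rangle$ be a numerical semigroup generated by positive integers $a_1,\dots,a_\ell$. Choose integers $m,n\in\mathbb N$ such that $\gcd(m,n)=1$ and $m\in H$ but $m\ne a_i$ for all $1\le i\le\ell$. Set $S:=nH+\langle m\rangle$. Let $k$ be a field, let $k[[t]]$ be the formal power series ring over $k$, and let $A:=k[[H]]=k[[t^h\mid h\in H]]$ and $R:=k[[S]]=k[[t^s\mid s\in S]]$ denote the numerical semigroup rings of $H$ and $S$ over $k$, respectively. Then there is an isomorphism of rings $R\cong A[X]/(X^n-t^m)$, where $A[X]$ denotes the polynomial ring over $A$. Hence $R$ is a free $A$-module of rank $n$. Consequently, if $A$ satisfies (SAC), then so does $R$.
   Context: A numerical semigroup is a submonoid of $(\mathbb{Z}_{\ge 0},+)$ with finite complement; $\langle a_1,\dots,a_\ell\rangle$ is the submonoid generated by $a_1,\dots,a_\ell$, and $nH+\langle m\rangle=\{nh+cm\mid h\in H,\ c\in\mathbb{Z}_{\ge0}\}$. Here $R$ is viewed as an $A$-module through the ring homomorphism $A\to R$ induced by $t\mapsto t^n$ (so $t^h\mapsto t^{nh}$). All rings are commutative Noetherian with identity. A ring $R$ satisfies (SAC) if for each finitely generated $R$-module $M$: whenever $\mathrm{Ext}_R^i(M,R)=0$ for all $i>0$ and $\mathrm{Ext}_R^i(M,M)=0$ for all sufficiently large $i$, one has $\mathrm{Ext}_R^i(M,M)=0$ for all $i>0$. *)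

(* Defs.v *)
From HB Require Import structures.
From mathcomp Require Import all_boot all_order all_algebra qpoly.
From mathcomp Require Import boolp classical_sets cardinality.

Set Implicit Arguments.
Unset Strict Implicit.
Unset Printing Implicit Defensive.

Import GRing.Theory.
Local Open Scope classical_set_scope.
Local Open Scope ring_scope.

Record natSubmonoid := NatSubmonoid {
  sm_set :> nat -> Prop;
  sm0 : sm_set 0%N;
  smD : forall x y, sm_set x -> sm_set y -> sm_set (x + y)%N
}.

Definition numerical_semigroup (H : natSubmonoid) : Prop :=
  finite_set (~` [set h | H h]).

Section Generated.
Variables (l : nat) (a : 'I_l -> nat).

Definition gen_set : set nat :=
  [set h | exists c : 'I_l -> nat, h = (\sum_(i < l) c i * a i)%N].

Fact gen_set0 : gen_set 0%N.
Proof. by exists (fun=> 0%N); rewrite big1. Qed.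

Fact gen_setD x y : gen_set x -> gen_set y -> gen_set (x + y)%N.
Proof.
move=> [c ->] [d ->]; exists (fun i => (c i + d i)%N).
by rewrite -big_split; apply: eq_bigr => i _; rewrite mulnDl.
Qed.

Definition gen_semigroup : natSubmonoid := NatSubmonoid gen_set0 gen_setD.
End Generated.

Section Gluing.
Variables (n : nat) (H : natSubmonoid) (m : nat).

Definition glue_set : set nat :=
  [set s | exists h c : nat, H h /\ s = (n * h + c * m)%N].

Fact glue_set0 : glue_set 0%N.
Proof. by exists 0%N, 0%N; rewrite muln0; split; first exact: sm0. Qed.

Fact glue_setD x y : glue_set x -> glue_set y -> glue_set (x + y)%N.
Proof.
move=> [h [c [Hh ->]]] [h' [c' [Hh' ->]]]; exists (h + h')%N, (c + c')%N.
by split; [exact: smD | rewrite mulnDr mulnDl addnACA].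
Qed.

Definition glue_semigroup : natSubmonoid := NatSubmonoid glue_set0 glue_setD.
End Gluing.

Lemma glue_exponent_gt0 (l : nat) (a : 'I_l -> nat) (m n : nat) :
    gcdn m n = 1%N -> gen_semigroup a m -> (forall i, m <> a i) -> (0 < n)%N.
Proof.
case: n => [|//]; rewrite gcdn0 => -> [c c1] a_neq1.
have [/existsP[i /eqP ca]|] := boolP [exists i, (c i * a i)%N == 1%N].
  by move/eqP: ca; rewrite muln_eq1 => /andP[_ /eqP a1]; case: (a_neq1 i).
rewrite negb_exists => /forallP ca; exfalso.
have [i ci0 | c0] := pickP (fun i => c i * a i != 0)%N.
  have: (c i * a i <= 1)%N by rewrite [in leqRHS]c1 (bigD1 i) //= leq_addr.
  by have := ca i; case: (c i * a i)%N ci0 => [|[|]].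
by move: c1; rewrite big1 // => i _; apply/eqP; have := c0 i; case: eqP.
Qed.

Record fps (R : Type) := FPS { fps_coef :> nat -> R }.

HB.instance Definition _ (R : Type) := gen_eqMixin (fps R).
HB.instance Definition _ (R : Type) := gen_choiceMixin (fps R).

Section FPS.
Variable R : comNzRingType.
Implicit Types f g h : fps R.

Lemma fpsP f g : (forall i, f i = g i) -> f = g.
Proof. by case: f g => [f] [g] /= /funext ->. Qed.

Definition fps0 : fps R := FPS (fun=> 0).
Definition fps1 : fps R := FPS (fun i => (i == 0%N)%:R).
Definition fps_opp f : fps R := FPS (fun i => - f i).
Definition fps_add f g : fps R := FPS (fun i => f i + g i).
Definition fps_mul f g : fps R :=
  FPS (fun i => \sum_(j < i.+1) f j * g (i - j)%N).

Fact fps_addA : associative fps_add.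
Proof. by move=> f g h; apply: fpsP => i /=; rewrite addrA. Qed.
Fact fps_addC : commutative fps_add.
Proof. by move=> f g; apply: fpsP => i /=; rewrite addrC. Qed.
Fact fps_add0 : left_id fps0 fps_add.
Proof. by move=> f; apply: fpsP => i /=; rewrite add0r. Qed.
Fact fps_addN : left_inverse fps0 fps_opp fps_add.
Proof. by move=> f; apply: fpsP => i /=; rewrite addNr. Qed.

HB.instance Definition _ :=
  GRing.isZmodule.Build (fps R) fps_addA fps_addC fps_add0 fps_addN.

Definition fps_trunc N f : {poly R} := \poly_(i < N.+1) f i.

Lemma coef_fps_trunc N f i : (i <= N)%N -> (fps_trunc N f)`_i = f i.
Proof. by move=> iN; rewrite coef_poly ltnS iN. Qed.

Lemma fps_mul_poly f g (p q : {poly R}) i :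
    (forall j, (j <= i)%N -> p`_j = f j) ->
    (forall j, (j <= i)%N -> q`_j = g j) ->
  fps_mul f g i = (p * q)`_i.
Proof.
move=> pf qg; rewrite coefM; apply: eq_bigr => j _.
by rewrite pf ?qg ?leq_subr // -ltnS.
Qed.

Fact fps_mulA : associative fps_mul.
Proof.
move=> f g h; apply: fpsP => i; pose T := fps_trunc i.
have TE f' j : (j <= i)%N -> (T f')`_j = f' j by exact: coef_fps_trunc.
have TM f' g' j : (j <= i)%N -> (T f' * T g')`_j = fps_mul f' g' j.
  move=> ji; symmetry; apply: fps_mul_poly => d dj; apply: TE;
  exact: leq_trans dj ji.
rewrite (@fps_mul_poly f _ (T f) (T g * T h)); [|exact: TE|exact: TM].
rewrite (@fps_mul_poly _ h (T f * T g) (T h)); [|exact: TM|exact: TE].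
by rewrite mulrA.
Qed.

Fact fps_mulC : commutative fps_mul.
Proof.
move=> f g; apply: fpsP => i; pose T := fps_trunc i.
have TE f' j : (j <= i)%N -> (T f')`_j = f' j by exact: coef_fps_trunc.
rewrite (@fps_mul_poly f g (T f) (T g)); try exact: TE.
by rewrite (@fps_mul_poly g f (T g) (T f)) 1?mulrC; try exact: TE.
Qed.

Fact fps_mul1 : left_id fps1 fps_mul.
Proof.
move=> f; apply: fpsP => i /=; rewrite big_ord_recl /= mul1r subn0.
by rewrite big1 ?addr0 // => j _; rewrite mul0r.
Qed.

Fact fps_mulDl : left_distributive fps_mul fps_add.
Proof.
move=> f g h; apply: fpsP => i /=; rewrite -big_split /=.
by apply: eq_bigr => j _; rewrite mulrDl.
Qed.

Fact fps_oner_neq0 : fps1 != 0 :> fps R.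
Proof.
by apply/eqP => /(congr1 (fun f : fps R => f 0%N))/eqP; rewrite /= oner_eq0.
Qed.

HB.instance Definition _ :=
  GRing.Zmodule_isComNzRing.Build (fps R)
    fps_mulA fps_mulC fps_mul1 fps_mulDl fps_oner_neq0.

Definition fps_Xn (m : nat) : fps R := FPS (fun i => (i == m)%:R).

(* f(t) |-> f(t^n).  For n = 0 the formula gives the constant
   term f(0). *)
Definition fps_expand (n : nat) f : fps R :=
  FPS (fun i => if (n %| i)%N then f (i %/ n)%N else 0).

Fact fps_expandB n : {morph fps_expand n : f g / f - g}.
Proof.
by move=> f g; apply: fpsP => i /=; case: ifP; rewrite // subr0.
Qed.

Fact fps_expand1 n : fps_expand n 1 = 1.
Proof.
apply: fpsP => i /=; case: ifPn => [/dvdnP[q ->]|].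
  by case: n => [|n]; rewrite ?muln0 // mulnK // muln_eq0 orbF.
by case: i => //; rewrite dvdn0.
Qed.

Fact fps_expandM n : {morph fps_expand n : f g / f * g}.
Proof.
move=> f g; apply: fpsP => i.
have [->|n_gt0] := posnP n.
  case: i => [|i] /=; first by rewrite !big_ord1.
  by rewrite big_ord_recl /= mulr0 add0r big1 // => j _; rewrite mul0r.
pose T f := fps_trunc i f \Po 'X^n.
have TE f' j : (j <= i)%N -> (T f')`_j = fps_expand n f' j.
  move=> ji; rewrite coef_comp_poly_Xn //=; case: ifP => // _.
  by rewrite coef_fps_trunc // (leq_trans (leq_div _ _)).
rewrite [RHS](@fps_mul_poly _ _ (T f) (T g)); try exact: TE.
rewrite -comp_polyM coef_comp_poly_Xn //=; case: ifP => // _.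
rewrite -(@fps_mul_poly f g) // => j ji; apply: coef_fps_trunc;
exact: leq_trans ji (leq_div _ _).
Qed.

End FPS.

(* k[[H]] is the subring of k[[t]] of the series supported in H. *)
Section SemigroupRing.
Variables (k : fieldType) (H : natSubmonoid).

Definition sgring_pred : {pred fps k} :=
  fun f => `[< forall i, f i != 0 -> H i >].

Lemma sgring_predP (f : fps k) :
  reflect (forall i, f i != 0 -> H i) (f \in sgring_pred).
Proof. exact: asboolP. Qed.

Fact sgring_subring_closed : subring_closed sgring_pred.
Proof.
split.
- apply/sgring_predP => i /=; have [->|_] := eqVneq i 0%N; first by move=> _; exact: sm0.
  by rewrite eqxx.
- move=> f g /sgring_predP Hf /sgring_predP Hg; apply/sgring_predP => i.
  apply: contraPP => nHi /=.
  have [/eqP fi|/eqP] := eqVneq (f i) 0; last by move/eqP/Hf.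
  have [/eqP gi|/eqP] := eqVneq (g i) 0; last by move/eqP/Hg.
  by rewrite (eqP fi) (eqP gi) subr0 eqxx.
- move=> f g /sgring_predP Hf /sgring_predP Hg; apply/sgring_predP => i.
  apply: contraPP => nHi /=; rewrite big1 ?eqxx // => j _.
  have [->|/Hf Hj] := eqVneq (f j) 0; first by rewrite mul0r.
  have [->|/Hg Hij] := eqVneq (g (i - j)%N) 0; first by rewrite mulr0.
  case: nHi; have <- : (j + (i - j))%N = i by rewrite subnKC // -ltnS.
  exact: smD.
Qed.

HB.instance Definition _ :=
  GRing.isSubringClosed.Build (fps k) sgring_pred sgring_subring_closed.

Record sgring := SGRing {
  sgval :> fps k;
  sgringP : sgval \in sgring_pred
}.

HB.instance Definition _ := [isSub for sgval].
HB.instance Definition _ := [Choice of sgring by <:].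
HB.instance Definition _ := [SubChoice_isSubComNzRing of sgring by <:].

Fact sg_Xn_subproof m : H m -> fps_Xn k m \in sgring_pred.
Proof.
move=> Hm; apply/sgring_predP => i /=.
by have [->|_] := eqVneq i m; rewrite ?eqxx.
Qed.

Definition sg_Xn m (Hm : H m) : sgring := SGRing (sg_Xn_subproof Hm).

End SemigroupRing.

(* The ring homomorphism k[[H]] -> k[[nH + <m>]] induced by t |-> t^n. *)
Section Expand.
Variables (k : fieldType) (H : natSubmonoid) (n m : nat).

Fact sg_expand_subproof (f : sgring k H) :
  fps_expand n f \in sgring_pred (glue_semigroup n H m).
Proof.
apply/sgring_predP => i /=; case: ifP => [n_i fi|]; last by rewrite eqxx.
exists (i %/ n)%N, 0%N; split; last by rewrite mulnC divnK // addn0.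
by have /sgring_predP := sgringP f; apply.
Qed.

Definition sg_expand (f : sgring k H) : sgring k (glue_semigroup n H m) :=
  SGRing (sg_expand_subproof f).

Fact sg_expand_is_zmod_morphism : zmod_morphism sg_expand.
Proof. by move=> f g; apply: val_inj; exact: fps_expandB. Qed.

Fact sg_expand_is_monoid_morphism : monoid_morphism sg_expand.
Proof.
by split=> [|f g]; apply: val_inj; [exact: fps_expand1 | exact: fps_expandM].
Qed.

HB.instance Definition _ :=
  GRing.isZmodMorphism.Build _ _ sg_expand sg_expand_is_zmod_morphism.
HB.instance Definition _ :=
  GRing.isMonoidMorphism.Build _ _ sg_expand sg_expand_is_monoid_morphism.
End Expand.
Arguments sg_expand : clear implicits.

(* {poly %/ p} is the quotient by mk_monic p, which is p only if p is monic and
   nonconstant. *)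
Lemma mk_monic_XnsubC (A : comNzRingType) (n : nat) (c : A) :
  (0 < n)%N -> mk_monic ('X^n - c%:P) = 'X^n - c%:P.
Proof.
move=> n_gt0; rewrite /mk_monic size_XnsubC // ltnS n_gt0.
by rewrite monicXnsubC.
Qed.

Definition restrict (A B : comNzRingType) (phi : {rmorphism A -> B}) : Type := B.

Section Restrict.
Variables (A B : comNzRingType) (phi : {rmorphism A -> B}).
Local Notation M := (restrict phi).

HB.instance Definition _ := GRing.Zmodule.copy M B.

Definition restrict_scale (x : A) (b : M) : M := phi x * (b : B).

Fact restrict_scaleA x y b :
  restrict_scale x (restrict_scale y b) = restrict_scale (x * y) b.
Proof. by rewrite /restrict_scale rmorphM mulrA. Qed.
Fact restrict_scale1 : left_id 1 restrict_scale.
Proof. by move=> b; rewrite /restrict_scale rmorph1 mul1r. Qed.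
Fact restrict_scaleDr : right_distributive restrict_scale +%R.
Proof. by move=> x b c; rewrite /restrict_scale mulrDr. Qed.
Fact restrict_scaleDl b : {morph restrict_scale^~ b : x y / x + y}.
Proof. by move=> x y; rewrite /restrict_scale rmorphD mulrDl. Qed.

HB.instance Definition _ := GRing.Zmodule_isLmodule.Build A M
  restrict_scaleA restrict_scale1 restrict_scaleDr restrict_scaleDl.
End Restrict.

Section Modules.
Variable R : comNzRingType.

Definition finitely_generated (M : lmodType R) : Prop :=
  exists (d : nat) (e : 'I_d -> M),
    forall x, exists c : 'I_d -> R, x = \sum_(i < d) c i *: e i.

Definition free_of_rank (d : nat) (M : lmodType R) : Prop :=
  exists e : 'I_d -> M,
    forall x, exists! c : {ffun 'I_d -> R}, x = \sum_(i < d) c i *: e i.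

Definition projective (P : lmodType R) : Prop :=
  forall (U V : lmodType R) (g : {linear U -> V}) (f : {linear P -> V}),
    (forall v, exists u, g u = v) ->
    exists h : {linear P -> U}, forall x, g (h x) = f x.

Record projective_resolution (M : lmodType R) := ProjectiveResolution {
  res_obj :> nat -> lmodType R;
  res_diff : forall i, {linear res_obj i.+1 -> res_obj i};
  res_aug : {linear res_obj 0%N -> M};
  res_projective : forall i, projective (res_obj i);
  res_aug_surj : forall x, exists y, res_aug y = x;
  res_exact0 : forall x, res_aug x = 0 <-> exists y, res_diff 0%N y = x;
  res_exactS : forall i x,
    res_diff i x = 0 <-> exists y, res_diff i.+1 y = x
}.

(* Cocycles and coboundaries of degree i of the complex Hom(P, N), where P is
   the deleted resolution, so that Ext^i(M, N) is the quotient. *)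
Definition ext_cocycle (M N : lmodType R) (P : projective_resolution M)
    (i : nat) (f : {linear P i -> N}) : Prop :=
  forall x, f (res_diff P i x) = 0.

Definition ext_coboundary (M N : lmodType R) (P : projective_resolution M)
    (i : nat) : {linear P i -> N} -> Prop :=
  match i with
  | 0%N => fun f => forall x, f x = 0
  | j.+1 => fun f =>
      exists g : {linear P j -> N}, forall x, f x = g (res_diff P j x)
  end.

Definition ext_vanishes (i : nat) (M N : lmodType R) : Prop :=
  forall (P : projective_resolution M) (f : {linear P i -> N}),
    ext_cocycle f -> ext_coboundary f.

End Modules.

Definition SAC (R : comNzRingType) : Prop :=
  forall M : lmodType R, finitely_generated M ->
    (forall i, (0 < i)%N -> ext_vanishes i M R^o) ->
    (exists d, forall i, (d <= i)%N -> ext_vanishes i M M) ->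
    forall i, (0 < i)%N -> ext_vanishes i M M.

(* Main.v *)
Require Import Defs.
From HB Require Import structures.
From mathcomp Require Import all_boot all_order all_algebra qpoly.
From mathcomp Require Import boolp classical_sets cardinality.
From mathcomp Require Import generic_quotient ring_quotient ring.

Set Implicit Arguments.
Unset Strict Implicit.
Unset Printing Implicit Defensive.

Import GRing.Theory.
Local Open Scope quotient_scope.
Local Open Scope ring_scope.

(* Write X = t^m in R, so that X^n is the image of tau = t^m in A. Since gcd(m, n) = 1
   and m lies in H, every element of S is uniquely n h + i m with h in H and i < n;
   so R is free over A on 1, X, ..., X^(n-1), which gives the isomorphism.

   For (SAC), let M be a finitely generated R-module with Ext_R^i(M, R) = 0 for i > 0
   and Ext_R^i(M, M) = 0 for large i. Replacing M by a syzygy we may assume that X is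
   regular on M. Put N = M/XM, and let Z be the A-syzygy of N inside the free cover of
   M; it is resolved by the cone of X acting on a resolution P of M.
   - Hom_A(R, A) is isomorphic to R, so Ext_A^i(M, A) = 0 for i > 0.
   - Hom_A(P, N) is filtered by the maps killing X^j P, with n successive quotients
     Hom_R(P, N); so Ext_A^i(M, N), hence Ext_A^i(Z, Z), vanishes for large i.
   - (SAC) for A gives Ext_A^i(Z, Z) = 0 for i > 0, which says that X acts surjectively
     on Ext_A^i(M, Z), hence on Ext_A^i(M, N). There X^n acts as tau, which kills N, so
     Ext_A^i(M, N) = 0 for i > 0.
   - The filtration now yields Ext_R^i(M, N) = Ext_R^(i+2)(M, N), so these vanish too,
     and X acts surjectively on Ext_R^i(M, M), which is zero because R is X-adically
     complete and M is X-adically separated.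
   When m = 0, coprimality forces n = 1 and S = H. *)

(** * Linear maps, submodules and quotient modules *)

Definition mk_linear (A : comNzRingType) (U V : lmodType A) (f : U -> V)
    (f_lin : linear f) : {linear U -> V} :=
  HB.pack f (GRing.isLinear.Build A U V *:%R f f_lin).

Record submodule (A : comNzRingType) (V : lmodType A) := Submodule {
  submod_set :> V -> Prop;
  submod0 : submod_set 0;
  submodP : forall a u v, submod_set u -> submod_set v -> submod_set (a *: u + v)
}.

Section SubmoduleType.
Variables (A : comNzRingType) (V : lmodType A) (U : submodule V).

Definition submod_pred : {pred V} := fun v => `[< U v >].

Fact submod_pred_closed : submod_closed submod_pred.
Proof.
split; first exact/asboolP/submod0.
by move=> a u v /asboolP Uu /asboolP Uv; exact/asboolP/submodP.
Qed.

HB.instance Definition _ :=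
  GRing.isSubmodClosed.Build A V submod_pred submod_pred_closed.

Record submod_type := SubmodElt {
  submod_val : V;
  submod_valP : submod_val \in submod_pred
}.

HB.instance Definition _ := [isSub for submod_val].
HB.instance Definition _ := [Choice of submod_type by <:].
HB.instance Definition _ := [SubChoice_isSubLmodule of submod_type by <:].

Lemma submod_valU (u : submod_type) : U (submod_val u).
Proof. exact/asboolP/submod_valP. Qed.

Definition submod_elt v (Uv : U v) : submod_type := SubmodElt (asboolT Uv).

Lemma submod_val_is_linear : linear submod_val.
Proof. by []. Qed.

Definition submod_quot : Type := Quotient.quot (submod_pred : zmodClosed V).
HB.instance Definition _ := GRing.Zmodule.on submod_quot.

Definition submod_pi (v : V) : submod_quot := \pi_(Quotient.quot (submod_pred : zmodClosed V)) v.

Lemma submod_pi_eq u v : submod_pi u = submod_pi v <-> U (u - v).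
Proof.
rewrite /submod_pi; split=> [/eqP|Uuv].
  by rewrite -Quotient.idealrBE => /asboolP.
by apply/eqP; rewrite -Quotient.idealrBE; apply/asboolP.
Qed.

Definition submod_quot_scale (a : A) (q : submod_quot) : submod_quot :=
  submod_pi (a *: repr (q : Quotient.quot (submod_pred : zmodClosed V))).

Lemma submod_pi_repr (q : submod_quot) :
  submod_pi (repr (q : Quotient.quot (submod_pred : zmodClosed V))) = q.
Proof. exact: reprK. Qed.

Lemma submod_piD u v : submod_pi (u + v) = submod_pi u + submod_pi v.
Proof. by rewrite /submod_pi raddfD. Qed.

Lemma submod_piZ a v : submod_pi (a *: v) = submod_quot_scale a (submod_pi v).
Proof.
apply/submod_pi_eq; rewrite -scalerBr -[_ *: _]addr0.
by apply: submodP (submod0 U); apply/submod_pi_eq; rewrite submod_pi_repr.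
Qed.

Fact submod_quot_scaleA a b q :
  submod_quot_scale a (submod_quot_scale b q) = submod_quot_scale (a * b) q.
Proof. by rewrite -(submod_pi_repr q) -!submod_piZ scalerA. Qed.
Fact submod_quot_scale1 : left_id 1 submod_quot_scale.
Proof. by move=> q; rewrite -(submod_pi_repr q) -!submod_piZ scale1r. Qed.
Fact submod_quot_scaleDr : right_distributive submod_quot_scale +%R.
Proof.
move=> a p q; rewrite -(submod_pi_repr p) -(submod_pi_repr q).
by rewrite -submod_piD -!submod_piZ scalerDr submod_piD.
Qed.
Fact submod_quot_scaleDl q :
  {morph submod_quot_scale^~ q : a b / a + b}.
Proof.
move=> a b; rewrite -(submod_pi_repr q) -!submod_piZ.
by rewrite scalerDl submod_piD.
Qed.
HB.instance Definition _ := GRing.Zmodule_isLmodule.Build A submod_quot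
  submod_quot_scaleA submod_quot_scale1 submod_quot_scaleDr
  submod_quot_scaleDl.

Lemma submod_pi_is_linear : linear (submod_pi : V -> submod_quot).
Proof. by move=> a u v; rewrite submod_piD submod_piZ. Qed.

End SubmoduleType.

HB.instance Definition _ (A : comNzRingType) (V : lmodType A)
    (U : submodule V) :=
  GRing.isLinear.Build A (submod_type U) V *:%R _ (@submod_val_is_linear A V U).
HB.instance Definition _ (A : comNzRingType) (V : lmodType A)
    (U : submodule V) :=
  GRing.isLinear.Build A V (submod_quot U) *:%R _ (@submod_pi_is_linear A V U).

(** * Projective modules and Ext computed from one resolution *)

Section Homological.
Variable A : comNzRingType.
Implicit Types M N V : lmodType A.

(** [projective] lifts only along surjections. The projection to [Q] from the fibre product of [g]
    and [f] is one, because the image of [g] contains that of [f]; a section of it yields [h]. *)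
Lemma projective_lift (Q V W : lmodType A) (g : {linear V -> W})
    (f : {linear Q -> W}) :
    projective Q -> (forall x, exists v, g v = f x) ->
  exists h : {linear Q -> V}, forall x, g (h x) = f x.
Proof.
move=> projQ gf.
pose pull : (V * Q)%type -> Prop := fun p => g p.1 = f p.2.
have pull0 : pull 0 by rewrite /pull /= !linear0.
have pullP a u v : pull u -> pull v -> pull (a *: u + v).
  by rewrite /pull /= !linearP => -> ->.
pose U := Submodule pull0 pullP.
have snd_lin : linear (fun u : submod_type U => (submod_val u).2) by [].
have fst_lin : linear (fun u : submod_type U => (submod_val u).1) by [].
have [x|h hE] := projQ (submod_type U) Q (mk_linear snd_lin) idfun.
  by have [v gv] := gf x; exists (@submod_elt _ _ U (v, x) gv).
exists (mk_linear fst_lin \o h : {linear _ -> _}) => x /=.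
by have := submod_valU (h x); rewrite /= /pull => ->; have /= -> := hE x.
Qed.

Lemma projective_prod (P Q : lmodType A) :
  projective P -> projective Q -> projective (P * Q)%type.
Proof.
move=> projP projQ U V g f g_surj.
have f1_lin : linear (fun x : P => f (x, 0)).
  move=> a u v; rewrite -linearP; congr (f _).
  by congr pair; rewrite /= scaler0 addr0.
have f2_lin : linear (fun x : Q => f (0, x)).
  move=> a u v; rewrite -linearP; congr (f _).
  by congr pair; rewrite /= scaler0 addr0.
have [h1 h1E] := projP U V g (mk_linear f1_lin) g_surj.
have [h2 h2E] := projQ U V g (mk_linear f2_lin) g_surj.
have h_lin : linear (fun x : P * Q => h1 x.1 + h2 x.2).
  by move=> a u v /=; rewrite !linearP scalerDr addrACA.
exists (mk_linear h_lin) => -[x y] /=; rewrite linearD h1E h2E /=.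
by rewrite -linearD; congr (f _); congr pair; rewrite /= ?addr0 ?add0r.
Qed.

(* [vanishes P i N]: the cohomology of [Hom (P, N)] in degree [i + 1] is zero. *)
Definition vanishes M (P : projective_resolution M) (i : nat) N : Prop :=
  forall f : {linear P i.+1 -> N},
    (forall x, f (res_diff P i.+1 x) = 0) ->
    exists g : {linear P i -> N}, forall x, f x = g (res_diff P i x).

Section Resolution.
Variables (M : lmodType A) (P : projective_resolution M).
Local Notation d := (res_diff P).

Lemma res_augd x : res_aug P (d 0 x) = 0.
Proof. by apply/res_exact0; exists x. Qed.

Lemma res_dd i x : d i (d i.+1 x) = 0.
Proof. by apply/res_exactS; exists x. Qed.

End Resolution.

Section Comparison.
Variables (M : lmodType A) (P P' : projective_resolution M).

(** The recursion that builds a chain map carries two consecutive components and the square between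
    them, because lifting the next component uses that square. *)
Definition chain_square i
    (ab : {linear P i -> P' i} * {linear P i.+1 -> P' i.+1}) : Prop :=
  forall x, res_diff P' i (ab.2 x) = ab.1 (res_diff P i x).

Lemma chain_square_start : exists ab : {ab | chain_square (i := 0) ab},
  forall x, res_aug P' ((sval ab).1 x) = res_aug P x.
Proof.
have [x|a aE] := projective_lift (g := res_aug P') (f := res_aug P)
  (@res_projective _ _ P 0).
  exact: res_aug_surj.
have [x|b bE] := projective_lift (g := res_diff P' 0)
  (f := a \o res_diff P 0) (@res_projective _ _ P 1).
  by apply/res_exact0; rewrite /= aE res_augd.
by exists (exist _ (a, b) bE).
Qed.

Lemma chain_square_step i (ab : {ab | chain_square (i := i) ab}) :
  exists bc : {bc | chain_square (i := i.+1) bc}, (sval bc).1 = (sval ab).2.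
Proof.
case: ab => -[a b] /= abE.
have [x|c cE] := projective_lift (g := res_diff P' i.+1)
  (f := b \o res_diff P i.+1) (@res_projective _ _ P i.+2).
  by apply/res_exactS; rewrite /= abE res_dd linear0.
by exists (exist _ (b, c) cE).
Qed.

Lemma comparison : exists phi : forall i, {linear P i -> P' i},
  (forall x, res_aug P' (phi 0 x) = res_aug P x) /\
  forall i x, res_diff P' i (phi i.+1 x) = phi i (res_diff P i x).
Proof.
have [ab0 ab0E] := chain_square_start.
pose ab := nat_rect (fun i => {ab | chain_square (i := i) ab}) ab0
  (fun i ab => sval (cid (chain_square_step ab))).
exists (fun i => (sval (ab i)).1); split=> // i x.
by rewrite /= (svalP (cid (chain_square_step (ab i)))) (svalP (ab i)).
Qed.

End Comparison.

Lemma null_homotopy M (P : projective_resolution M)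
    (theta : forall i, {linear P i -> P i}) :
    (forall x, res_aug P (theta 0 x) = 0) ->
    (forall i x, res_diff P i (theta i.+1 x) = theta i (res_diff P i x)) ->
  forall i, exists (s : {linear P i -> P i.+1})
                   (s' : {linear P i.+1 -> P i.+2}),
    forall x, theta i.+1 x = res_diff P i.+1 (s' x) + s (res_diff P i x).
Proof.
move=> theta0 thetaS.
(* The part of the homotopy relation that the next lift needs: it makes the values of
   [theta i.+1 - s d] cycles. *)
pose homotopic i (s : {linear P i -> P i.+1}) := forall x,
  res_diff P i (s (res_diff P i x)) = theta i (res_diff P i x).
have step i (s : {linear P i -> P i.+1}) : homotopic i s ->
    exists s' : {linear P i.+1 -> P i.+2},
      forall x, res_diff P i.+1 (s' x) = theta i.+1 x - s (res_diff P i x).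
  move=> sE; apply: (projective_lift (g := res_diff P i.+1)
    (f := theta i.+1 \- (s \o res_diff P i)) (@res_projective _ _ P i.+1)).
  by move=> x; apply/res_exactS; rewrite linearB /= thetaS sE subrr.
move=> i; suff [s /[dup] sE /step [s' s'E]] : exists s, homotopic i s.
  by exists s, s' => x; rewrite s'E subrK.
elim: i => [|i [s /[dup] sE /step [s' s'E]]].
  have [x|s sE] := projective_lift (g := res_diff P 0) (f := theta 0)
    (@res_projective _ _ P 0).
    exact/res_exact0.
  by exists s => x; rewrite sE.
by exists s' => x; rewrite s'E res_dd linear0 subr0.
Qed.

(** Comparison maps in both directions compose to an endomorphism of [P'] homotopic to the identity,
    so a cocycle on [P'] is cohomologous to its pull-back through [P]. *)
Lemma vanishes_indep M N (P P' : projective_resolution M) i :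
  vanishes P i N -> vanishes P' i N.
Proof.
move=> van f fd; have [phi [phi0 phiS]] := comparison P P'.
have [psi [psi0 psiS]] := comparison P' P.
have [x|g gE] := van (f \o phi i.+1); first by rewrite /= -phiS fd.
pose theta j : {linear P' j -> P' j} := (phi j \o psi j) \- idfun.
have [x|j x|s [s' sE]] := @null_homotopy _ P' theta _ _ i.
- by rewrite /= linearB /= phi0 psi0 subrr.
- by rewrite /= linearB /= phiS psiS.
exists ((g \o psi i) \- (f \o s)) => x /=.
rewrite -psiS -gE /=; have := congr1 f (sE x).
by rewrite [X in _ = X]linearD fd add0r /= linearB /= => <-; rewrite subKr.
Qed.

(** [ext_vanishes] quantifies over all resolutions; by independence of the choice a single one
    decides it. *)
Lemma ext_vanishesP M N (P : projective_resolution M) i :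
  ext_vanishes i.+1 M N <-> vanishes P i N.
Proof.
split=> [ext f fd|van P' f]; first exact: ext P f fd.
exact: vanishes_indep van f.
Qed.

(** * Long exact sequences in the second argument of Ext *)

Section Sequence.
Variables (M : lmodType A) (P : projective_resolution M).
Variables (N' N N'' : lmodType A).
Variables (io : {linear N' -> N}) (pi : {linear N -> N''}).
Hypothesis io_inj : injective io.
Hypothesis pi_surj : forall z, exists y, pi y = z.
Hypothesis pi_io : forall y, pi (io y) = 0.
Hypothesis exact_mid : forall y, pi y = 0 -> exists x, io x = y.
Local Notation d := (res_diff P).

Let lift_pi i (f : {linear P i -> N''}) :
  exists h : {linear P i -> N}, forall x, pi (h x) = f x.
Proof. exact: projective_lift (@res_projective _ _ P i) _. Qed.

Let lift_io i (f : {linear P i -> N}) : (forall x, pi (f x) = 0) ->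
  exists h : {linear P i -> N'}, forall x, io (h x) = f x.
Proof.
by move=> pif; apply: projective_lift (@res_projective _ _ P i) _ => x; exact: exact_mid.
Qed.

(** Exactness at [N'']: the obstruction to lifting a cocycle to [N] is a cocycle [u] into [N'], one
    degree higher. *)
Lemma vanishes_quot i : vanishes P i N -> vanishes P i.+1 N' -> vanishes P i N''.
Proof.
move=> vN vN' f fd; have [h hE] := lift_pi f.
have [x|u uE] := lift_io (f := h \o d i.+1); first by rewrite /= hE fd.
have [x|v vE] := vN' u; first by apply: io_inj; rewrite uE /= res_dd !linear0.
have [x|g gE] := vN (h \- (io \o v)); first by rewrite /= -vE uE subrr.
exists (pi \o g) => x /=; rewrite -gE /= linearB /= pi_io subr0.
exact/esym/hE.
Qed.

(** Exactness at [N'], with the connecting map coming from [N''] one degree lower. *)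
Lemma vanishes_sub i : vanishes P i N'' -> vanishes P i.+1 N -> vanishes P i.+1 N'.
Proof.
move=> vN'' vN f fd.
have [x|g gE] := vN (io \o f); first by rewrite /= fd linear0.
have [x|h hE] := vN'' (pi \o g); first by rewrite /= -gE /= pi_io.
have [h' h'E] := lift_pi h.
have [x|w wE] := lift_io (f := g \- (h' \o d i)).
  by rewrite /= linearB /= h'E -hE subrr.
exists w => x; apply: io_inj; rewrite wE /= res_dd linear0 subr0.
exact: gE.
Qed.

End Sequence.

(* [xi] acts surjectively on the cohomology of [Hom (P, N)] in degree [i + 1]. *)
Definition xi_surjective M (P : projective_resolution M)
    (xi : forall i, {linear P i -> P i}) (i : nat) N : Prop :=
  forall f : {linear P i.+1 -> N}, (forall x, f (res_diff P i.+1 x) = 0) ->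
  exists (f' : {linear P i.+1 -> N}) (g : {linear P i -> N}),
    (forall x, f' (res_diff P i.+1 x) = 0) /\
    (forall x, f x = f' (xi i.+1 x) + g (res_diff P i x)).

Section SequenceXi.
Variables (M : lmodType A) (P : projective_resolution M).
Variable (xi : forall i, {linear P i -> P i}).
Hypothesis xi_d : forall i x, res_diff P i (xi i.+1 x) = xi i (res_diff P i x).
Variables (N' N N'' : lmodType A).
Variables (io : {linear N' -> N}) (pi : {linear N -> N''}).
Hypothesis io_inj : injective io.
Hypothesis pi_surj : forall z, exists y, pi y = z.
Hypothesis pi_io : forall y, pi (io y) = 0.
Hypothesis exact_mid : forall y, pi y = 0 -> exists x, io x = y.
Local Notation d := (res_diff P).

(** As the cohomology of [N] vanishes in both degrees, the connecting map identifies that of [N'']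
    with that of [N'] one degree higher, compatibly with [xi]. *)
Lemma xi_surjective_quot i : vanishes P i N -> vanishes P i.+1 N ->
  xi_surjective xi i.+1 N' -> xi_surjective xi i N''.
Proof.
move=> vN vN1 sN' f fd.
have [h hE] : exists h : {linear P i.+1 -> N}, forall x, pi (h x) = f x.
  exact: projective_lift (@res_projective _ _ P _) _.
have [u uE] : exists u : {linear P i.+2 -> N'},
    forall x, io (u x) = (h \o d i.+1) x.
  apply: projective_lift (@res_projective _ _ P _) _ => x.
  by apply: exact_mid; rewrite /= hE fd.
have [x|u' [v [u'd uE']]] := sN' u.
  by apply: io_inj; rewrite uE /= res_dd !linear0.
(* [pi \o w] is the cocycle whose class the connecting map sends to that of [u']. *)
have [x|w wE] := vN1 (io \o u'); first by rewrite /= u'd linear0.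
have [x|g gE] := vN (h \- ((w \o xi i.+1) \+ (io \o v))).
  rewrite /= -xi_d -wE /= -linearD -uE' uE /=.
  by rewrite subrr.
exists (pi \o w), (pi \o g); split=> x /=; first by rewrite -wE /= pi_io.
by rewrite -linearD -gE /= opprD addrCA addNKr linearB /= pi_io subr0 hE.
Qed.

End SequenceXi.

(** An endomorphism that is both surjective and nilpotent lives on zero; the iteration runs on
    cocycles and collects the coboundaries on the way. *)
Lemma xi_nilpotent_vanishes M (P : projective_resolution M)
    (xi : forall i, {linear P i -> P i}) i N n :
    (forall i x, res_diff P i (xi i.+1 x) = xi i (res_diff P i x)) ->
    (forall (f : {linear P i.+1 -> N}) x, f (iter n (xi i.+1) x) = 0) ->
  xi_surjective xi i N -> vanishes P i N.
Proof.
move=> xi_d nilp surj f fd.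
suff [f' [g [f'd fE]]] : exists (f' : {linear P i.+1 -> N})
    (g : {linear P i -> N}), (forall x, f' (res_diff P i.+1 x) = 0) /\
    (forall x, f x = f' (iter n (xi i.+1) x) + g (res_diff P i x)).
  by exists g => x; rewrite fE nilp add0r.
elim: (n) => [|j [f' [g [f'd fE]]]].
  by exists f, \0; split=> // x /=; rewrite addr0.
have [f'' [g' [f''d f'E]]] := surj _ f'd.
have iter_d x : res_diff P i (iter j (xi i.+1) x) = iter j (xi i) (res_diff P i x).
  by elim: (j) => //= j' <-; rewrite xi_d.
have [xij xijE] : exists xij : {linear P i -> P i}, forall x, xij x = iter j (xi i) x.
  elim: (j) => [|j' [xij xijE]]; first by exists idfun.
  by exists (xi i \o xij) => x /=; rewrite xijE.
exists f'', ((g' \o xij) \+ g); split=> // x.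
rewrite fE f'E iter_d /= xijE. by rewrite addrA.
Qed.

End Homological.

(** * The cone of an endomorphism of a resolution *)

Section Cone.
Variables (A : comNzRingType) (M : lmodType A) (P : projective_resolution M).
Variables (xi : forall i, {linear P i -> P i}) (xiM : {linear M -> M}).
Hypothesis xi_d : forall i x, res_diff P i (xi i.+1 x) = xi i (res_diff P i x).
Hypothesis xi_aug : forall x, res_aug P (xi 0 x) = xiM (res_aug P x).
Hypothesis xiM_inj : injective xiM.
Local Notation d := (res_diff P).

(** The kernel of the composite of [res_aug P] with the projection of [M] onto its quotient by the
    image of [xiM], described without forming that quotient. *)
Definition cone_set (p : P 0) : Prop := exists y, res_aug P p = xiM y.

Fact cone_set0 : cone_set 0.
Proof. by exists 0; rewrite !linear0. Qed.
Fact cone_setP a p q : cone_set p -> cone_set q -> cone_set (a *: p + q).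
Proof. by move=> [x px] [y qy]; exists (a *: x + y); rewrite !linearP px qy. Qed.

Definition cone_syzygy : submodule (P 0) := Submodule cone_set0 cone_setP.
Local Notation Z := (submod_type cone_syzygy).

Fact cone_aug_subproof (x : P 1 * P 0) : cone_syzygy (d 0 x.1 + xi 0 x.2).
Proof. by exists (res_aug P x.2); rewrite linearD res_augd add0r xi_aug. Qed.

Definition cone_aug (x : P 1 * P 0) : Z := submod_elt (cone_aug_subproof x).

Fact cone_aug_is_linear : linear cone_aug.
Proof.
move=> a x y; apply: val_inj; rewrite /= !linearP scalerDr !addrA.
by congr (_ + _); rewrite addrAC.
Qed.

(** The mapping cone with its lowest term [P 0] removed: degree [i] of the resolution below is
    degree [i + 1] of the cone. *)
Definition cone_diff i (x : P i.+2 * P i.+1) : P i.+1 * P i :=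
  (d i.+1 x.1 + xi i.+1 x.2, - d i x.2).

Fact cone_diff_is_linear i : linear (@cone_diff i).
Proof.
move=> a x y; rewrite /cone_diff /= !linearP; congr pair => /=.
by rewrite scalerDr !addrA; congr (_ + _); rewrite addrAC.
Qed.

Fact cone_projective i : projective (P i.+1 * P i)%type.
Proof. by apply: projective_prod; exact: res_projective. Qed.

Fact cone_aug_surj z : exists x, mk_linear cone_aug_is_linear x = z.
Proof.
have [y zy] := submod_valU z; have [q qy] := res_aug_surj P y.
have /res_exact0[p pE] : res_aug P (submod_val z - xi 0 q) = 0.
  by rewrite linearB /= zy xi_aug qy subrr.
by exists (p, q); apply: val_inj; rewrite /= pE subrK.
Qed.

(** [K] stands for the cycles in degree [i]: the kernel of the augmentation when [i] is 0, of the
    differential otherwise. Both exactness proofs share this argument. *)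
Let kernel_d i (K : P i -> Prop) (p : P i.+1) (q : P i) :
  (forall x, K x -> exists y, d i y = x) ->
  (forall x, d i x = 0 -> exists y, d i.+1 y = x) -> K q -> d i p + xi i q = 0 ->
  exists a, cone_diff a = (p, q).
Proof.
move=> Kex dex /Kex[b bq] pq.
have [|a aE] := dex (p + xi i.+1 b); first by rewrite linearD /= xi_d bq.
exists (a, - b); rewrite /cone_diff /=.
by congr pair; rewrite linearN ?aE ?addrK // bq opprK.
Qed.

Fact cone_exact0 x : mk_linear cone_aug_is_linear x = 0 <->
  exists y, mk_linear (@cone_diff_is_linear 0) y = x.
Proof.
case: x => p q; split=> [/(congr1 val) /= pq|[y <-]]; last first.
  by apply: val_inj; rewrite /= linearD linearN /= res_dd xi_d add0r subrr.
apply: (@kernel_d 0 (fun q => res_aug P q = 0)) => //.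
- by move=> z /res_exact0.
- by move=> z /res_exactS.
(* Augmenting [d p + xi q = 0] gives only [xiM (res_aug q) = 0]; injectivity of [xiM] makes [q] a
   cycle. *)
apply: xiM_inj; rewrite -xi_aug linear0; move/(congr1 (res_aug P)): pq.
by rewrite linearD res_augd add0r linear0.
Qed.

Fact cone_exactS i x : mk_linear (@cone_diff_is_linear i) x = 0 <->
  exists y, mk_linear (@cone_diff_is_linear i.+1) y = x.
Proof.
case: x => p q; split=> [[pq /eqP] |[y <-]]; last first.
  rewrite /= /cone_diff /= linearD linearN /= res_dd xi_d add0r subrr.
  by rewrite linearN /= res_dd !oppr0.
rewrite oppr_eq0 => /eqP qd.
apply: (@kernel_d i.+1 (fun q => d i q = 0)) => // z; by move/res_exactS.
Qed.

Definition cone_resolution : projective_resolution Z :=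
  @ProjectiveResolution A Z (fun i => (P i.+1 * P i)%type)
    (fun i => mk_linear (@cone_diff_is_linear i)) (mk_linear cone_aug_is_linear)
    cone_projective cone_aug_surj cone_exact0 cone_exactS.

(** A cocycle [F] is a pair of maps. The first is a cocycle of [P], the coboundary of some [u];
    subtracting [u \o xi] from the second leaves a cocycle of [P] too. *)
Lemma cone_vanishes i W : vanishes P i W -> vanishes P i.+1 W ->
  vanishes cone_resolution i W.
Proof.
move=> vW vW1 F Fd.
have F1_lin : linear (fun x : P i.+2 => F (x, 0)).
  move=> a u v; rewrite -linearP; congr (F _).
  by congr pair; rewrite /= scaler0 addr0.
have F2_lin : linear (fun x : P i.+1 => F (0, x)).
  move=> a u v; rewrite -linearP; congr (F _).
  by congr pair; rewrite /= scaler0 addr0.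
have FE x : F x = mk_linear F1_lin x.1 + mk_linear F2_lin x.2.
  case: x => x y; rewrite /= -linearD.
  by congr (F _); congr pair; rewrite /= ?addr0 ?add0r.
have [x|u uE] := vW1 (mk_linear F1_lin).
  rewrite -(Fd (x, 0)) /= /cone_diff; congr (F _).
  by congr pair; rewrite /= !linear0 ?addr0.
have [x|v vE] := vW (mk_linear F2_lin \- (u \o xi i.+1)).
  have := Fd (0, x); rewrite FE [_.1]/= [_.2]/= linear0 add0r uE xi_d => /eqP.
  by rewrite linearN /= subr_eq0 => /eqP->; rewrite subrr.
have G_lin : linear (fun x : P i.+1 * P i => u x.1 - v x.2).
  by move=> a x y; rewrite /= !linearP scalerDr addrACA.
exists (mk_linear G_lin) => -[x y].
rewrite FE [_.1]/= [_.2]/= uE /= linearN opprK linearD -addrA.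
by congr (_ + _); rewrite -vE /= [RHS]addrC subrK.
Qed.

(** The pair [(0, f)] is a cocycle of the cone. If it bounds a pair, the first entry is a cocycle
    [f'] and the second gives the coboundary in [f = f' xi + g d]. *)
Lemma xi_surjective_cone i W :
  vanishes cone_resolution i W -> xi_surjective xi i W.
Proof.
move=> vW f fd.
have F_lin : linear (fun x : P i.+2 * P i.+1 => f x.2).
  by move=> a x y; rewrite /= linearP.
have [x|G GE] := vW (mk_linear F_lin).
  by rewrite /= linearN /= fd oppr0.
have u_lin : linear (fun x : P i.+1 => G (x, 0)).
  move=> a u v; rewrite -linearP; congr (G _).
  by congr pair; rewrite /= scaler0 addr0.
have v_lin : linear (fun x : P i => G (0, - x)).
  move=> a u v; rewrite -linearP; congr (G _).
  by congr pair; rewrite /= ?scaler0 ?addr0 // opprD scalerN.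
exists (mk_linear u_lin), (mk_linear v_lin); split=> x.
  have := GE (x, 0); rewrite /= linear0 => ->; congr (G _).
  by rewrite /cone_diff /= !linear0 addr0.
have := GE (0, x); rewrite /= => ->; rewrite -linearD; congr (G _).
by congr pair; rewrite /= ?linear0 ?addr0 ?add0r.
Qed.

(** (SAC) is applied to the syzygy [Z]: [cone_vanishes] with [W] equal to [A] and to [Z] supplies
    its hypotheses. *)
Lemma SAC_xi_surjective : SAC A -> finitely_generated Z ->
    (forall i, vanishes P i A^o) ->
    (exists c, forall i, (c <= i)%N -> vanishes P i Z) ->
  forall i, xi_surjective xi i Z.
Proof.
move=> sacA fgZ vA [c vZ] i; apply: xi_surjective_cone.
apply/ext_vanishesP/sacA => // [[//|j] _|].
  by apply/(ext_vanishesP _ cone_resolution)/cone_vanishes.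
exists c.+1 => -[//|j cj].
by apply/(ext_vanishesP _ cone_resolution)/cone_vanishes; apply: vZ => //; exact: leqW.
Qed.

End Cone.

(** * Finitely generated projective modules and restriction of scalars *)

(** By the dual basis criterion this means finitely generated projective. The index type is any
    finite type, so that pairs can index the generators after restriction of scalars. *)
Definition dual_basis (A : comNzRingType) (I : finType) (V : lmodType A) : Prop :=
  exists (e : I -> V) (c : I -> {linear V -> A^o}),
    forall x, x = \sum_i c i x *: e i.

Section DualBasis.
Variables (A : comNzRingType) (I : finType) (V : lmodType A).

Lemma fin_generated (e : I -> V) :
  (forall x, exists c : I -> A, x = \sum_i c i *: e i) -> finitely_generated V.
Proof.
move=> gen; exists #|I|, (e \o enum_val) => x; have [c ->] := gen x.
exists (c \o enum_val).
exact: (reindex _ (onW_bij _ (enum_val_bij I))).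
Qed.

Hypothesis V_basis : dual_basis I V.

Lemma dual_basis_projective : projective V.
Proof.
case: V_basis => e [c ce] U W g f g_surj.
have [u uE] : exists u : I -> U, forall i, g (u i) = f (e i).
  by exists (fun i => sval (cid (g_surj (f (e i))))) => i; case: cid.
have h_lin : linear (fun x => \sum_i c i x *: u i).
  move=> a x y; rewrite scaler_sumr -big_split; apply: eq_bigr => i _ /=.
  by rewrite linearP scalerDl scalerA.
exists (mk_linear h_lin) => x; rewrite [in RHS](ce x) /= !linear_sum /=.
by apply: eq_bigr => i _; rewrite !linearZ uE.
Qed.

(** [V] is a direct summand of a finite power of [A], and cocycles are bounded coordinate by
    coordinate. *)
Lemma dual_basis_vanishes (M : lmodType A) (P : projective_resolution M) i :
  vanishes P i A^o -> vanishes P i V.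
Proof.
case: V_basis => e [c ce] vA f fd.
have vanc j : exists g : {linear P i -> A^o}, forall x, c j (f x) = g (res_diff P i x).
  by have [x|g gE] := vA (c j \o f); [rewrite /= fd linear0 | exists g].
pose g j := sval (cid (vanc j)).
have gE j x : c j (f x) = g j (res_diff P i x) by rewrite /g; case: cid.
have h_lin : linear (fun x => \sum_j g j x *: e j).
  move=> a x y; rewrite scaler_sumr -big_split; apply: eq_bigr => j _ /=.
  by rewrite linearP scalerDl scalerA.
exists (mk_linear h_lin) => x; rewrite (ce (f x)) /=.
by apply: eq_bigr => j _; rewrite gE.
Qed.

End DualBasis.

Lemma dual_basis_rV (A : comNzRingType) p : dual_basis 'I_p 'rV[A]_p.
Proof.
have c_lin j : linear (fun x : 'rV[A]_p => x 0 j : A^o).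
  by move=> a x y; rewrite !mxE.
exists (fun j => delta_mx 0 j), (fun j => mk_linear (c_lin j)) => x.
exact: row_sum_delta.
Qed.

(** Restriction of scalars for any module, whereas [restrict] treats the ring itself. The carrier is
    kept, so both scalar actions are available on the same elements. *)
Definition resmod (A R : comNzRingType) (phi : {rmorphism A -> R})
  (V : lmodType R) : Type := V.

Section Restriction.
Variables (A R : comNzRingType) (phi : {rmorphism A -> R}).
Local Notation resmod := (resmod phi).

Section ResMod.
Variable V : lmodType R.
HB.instance Definition _ := GRing.Zmodule.copy (resmod V) V.

Definition resmod_scale (a : A) (v : resmod V) : resmod V := phi a *: (v : V).

Fact resmod_scaleA a b v : resmod_scale a (resmod_scale b v) = resmod_scale (a * b) v.
Proof. by rewrite /resmod_scale scalerA rmorphM. Qed.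
Fact resmod_scale1 : left_id 1 resmod_scale.
Proof. by move=> v; rewrite /resmod_scale rmorph1 scale1r. Qed.
Fact resmod_scaleDr : right_distributive resmod_scale +%R.
Proof. by move=> a v w; rewrite /resmod_scale scalerDr. Qed.
Fact resmod_scaleDl v : {morph resmod_scale^~ v : a b / a + b}.
Proof. by move=> a b; rewrite /resmod_scale rmorphD scalerDl. Qed.
HB.instance Definition _ := GRing.Zmodule_isLmodule.Build A (resmod V)
  resmod_scaleA resmod_scale1 resmod_scaleDr resmod_scaleDl.
End ResMod.

Lemma resmodZ (V : lmodType R) a (v : V) :
  a *: (v : resmod V) = (phi a *: v : V).
Proof. by []. Qed.

Fact res_linear_subproof (V W : lmodType R) (f : {linear V -> W}) :
  linear (f : resmod V -> resmod W).
Proof. by move=> a x y; rewrite !resmodZ linearP. Qed.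

Definition res_linear (V W : lmodType R) (f : {linear V -> W}) :
  {linear resmod V -> resmod W} := mk_linear (res_linear_subproof f).

Section ResResolution.
Variables (M : lmodType R) (P : projective_resolution M).
Hypothesis projA : forall i, projective (resmod (P i)).

Definition res_resolution : projective_resolution (resmod M) :=
  @ProjectiveResolution A (resmod M) (fun i => resmod (P i))
    (fun i => res_linear (res_diff P i)) (res_linear (res_aug P))
    projA (res_aug_surj P) (@res_exact0 _ _ P) (@res_exactS _ _ P).
End ResResolution.

End Restriction.

(* [R] is free over [A] on [1, X, ..., X^n'], with coordinates [co], and
   [X^(n'.+1) = tau]. *)
Section Extension.
Variables (A R : comNzRingType) (phi : {rmorphism A -> R}).
Variables (X : R) (n' : nat) (tau : A) (co : nat -> R -> A).
Local Notation n := n'.+1.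
Hypothesis co_lin : forall i a r s, co i (phi a * r + s) = a * co i r + co i s.
Hypothesis co_X : forall i j, (i < n)%N -> (j < n)%N -> co i (X ^+ j) = (i == j)%:R.
Hypothesis co_sum : forall r, r = \sum_(i < n) phi (co i r) * X ^+ i.
Hypothesis phi_tau : phi tau = X ^+ n.
Local Notation res := (resmod phi).

Lemma coD i r s : co i (r + s) = co i r + co i s.
Proof. by rewrite -{1}[r]mul1r -(rmorph1 phi) co_lin mul1r. Qed.

Lemma co0 i : co i 0 = 0.
Proof. by apply: (addIr (co i 0)); rewrite -coD !add0r. Qed.

Lemma coZ i a r : co i (phi a * r) = a * co i r.
Proof. by rewrite -[_ * r]addr0 co_lin co0 addr0. Qed.

Lemma co_bigsum i (J : finType) (F : J -> R) :
  co i (\sum_j F j) = \sum_j co i (F j).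
Proof. exact: (big_morph _ (coD i) (co0 i)). Qed.

(** [X] shifts coordinates upwards; the top one wraps around, multiplied by [tau], to coordinate 0,
    which [i.+1] avoids. *)
Lemma co_mulX i r : (i < n')%N -> co i.+1 (X * r) = co i r.
Proof.
move=> i_n; rewrite {1}[r]co_sum mulr_sumr co_bigsum big_ord_recr /=.
rewrite mulrCA -exprS -phi_tau -rmorphM -[phi _]mulr1 -(expr0 X) coZ co_X //.
rewrite mulr0 addr0 (bigD1 (Ordinal i_n)) //= mulrCA -exprS coZ co_X //.
rewrite eqxx mulr1 big1 ?addr0 // => j ji; rewrite mulrCA -exprS coZ co_X //.
  by rewrite eqSS -[i]/(val (Ordinal i_n)) eq_sym (inj_eq val_inj) (negPf ji) mulr0.
exact: ltn_ord.
Qed.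

(** The powers of [X] span [R] over [A], so commuting with [X] is enough. *)
Lemma linear_generated (V W : lmodType R) (f : {linear res V -> res W}) :
  (forall x : V, f (X *: x) = X *: (f x : W)) -> linear (f : V -> W).
Proof.
move=> fX r x y; rewrite (linearD f); congr (_ + _).
have fXn j z : f (X ^+ j *: (z : V)) = X ^+ j *: (f z : W).
  by elim: j => [|j IH]; rewrite ?scale1r // exprS -!scalerA fX IH.
rewrite [r]co_sum !scaler_suml (linear_sum f); apply: eq_bigr => i _.
rewrite -!scalerA -fXn; exact: linearZ_LR f (co i r) (X ^+ i *: x : V).
Qed.

Lemma dual_basis_res (I : finType) (V : lmodType R) :
  dual_basis I V -> dual_basis (I * 'I_n)%type (res V).
Proof.
move=> [e [c ce]].
have co_c_lin (k : I * 'I_n) : linear (fun x : res V => co k.2 (c k.1 x) : A^o).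
  move=> a x y; rewrite resmodZ linearP; exact: co_lin.
exists (fun k : I * 'I_n => X ^+ k.2 *: e k.1 : V), (fun k => mk_linear (co_c_lin k)) => x.
rewrite -(pair_bigA _ (fun i (j : 'I_n) => (co j (c i x)) *: (X ^+ j *: e i : res V))) /=.
rewrite [LHS](ce x); apply: eq_bigr => i _; rewrite {1}[c i x]co_sum scaler_suml.
by apply: eq_bigr => j _; rewrite resmodZ scalerA.
Qed.

Definition divX (r : R) : R := \sum_(i < n') phi (co i.+1 r) * X ^+ i.

(** The error is the top coordinate of [r]: [X] moves it to coordinate 0, where [divX] drops it. *)
Lemma divX_mulX r : divX (X * r) = r - X ^+ n' * phi (co n' r).
Proof.
rewrite {2}[r]co_sum big_ord_recr /= [X ^+ n' * _]mulrC addrK.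
by apply: eq_bigr => i _; rewrite co_mulX.
Qed.

Lemma divX_linear a r s : divX (phi a * r + s) = phi a * divX r + divX s.
Proof.
rewrite mulr_sumr -big_split; apply: eq_bigr => i _ /=.
by rewrite co_lin rmorphD rmorphM mulrDl mulrA.
Qed.

(** An [A]-linear left inverse of [X] modulo [X ^+ n']. Composing with it divides by [X] any map
    that kills [X ^+ j] with [j <= n']. *)
Definition has_divX (V : lmodType R) := exists sig : {linear res V -> res V},
  forall x : V, exists w : V, sig (X *: x) = x + X ^+ n' *: w.

Lemma dual_basis_divX (I : finType) (V : lmodType R) : dual_basis I V -> has_divX V.
Proof.
move=> [e [c ce]].
have sig_lin : linear (fun x : res V => \sum_i divX (c i x) *: e i : res V).
  move=> a x y; rewrite !resmodZ scaler_sumr -big_split; apply: eq_bigr => i _.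
  by rewrite linearP /= divX_linear scalerDl scalerA.
exists (mk_linear sig_lin) => x; exists (\sum_i (- phi (co n' (c i x))) *: e i).
rewrite {2}(ce x) scaler_sumr -big_split; apply: eq_bigr => i _ /=.
rewrite linearZ /= divX_mulX scalerBl.
by rewrite scaleNr scalerN scalerA.
Qed.

(** * Comparison of cohomology over [R] and over [A] *)

Section Transfer.
Variables (M : lmodType R) (P : projective_resolution M).
Hypothesis projA : forall i, projective (res (P i)).
Local Notation PA := (res_resolution projA).
Local Notation d := (res_diff P).

(* [Hom_A (R, A)] is isomorphic to [R]: an [A]-linear [f] is the top coordinate of
   the [R]-linear [x |-> \sum_j f (X^(n' - j) x) X^j]. *)
Lemma vanishes_frobenius i : vanishes P i R^o -> vanishes PA i A^o.
Proof.
move=> vR f fd.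
have fP a (u v : P i.+1) : f (phi a *: u + v) = a * f u + f v.
  exact: linearP f a u v.
pose F (x : P i.+1) : R := \sum_(j < n) X ^+ j * phi (f (X ^+ (n' - j) *: x)).
have F_A_lin : linear (F : res (P i.+1) -> res R^o).
  move=> a x y; rewrite !resmodZ /F scaler_sumr -big_split; apply: eq_bigr => j _ /=.
  by rewrite scalerDr scalerA [_ * phi a]mulrC -scalerA fP rmorphD mulrDr; congr (_ + _); rewrite rmorphM mulrCA.
have F_lin : linear (F : P i.+1 -> R^o).
  apply: (@linear_generated _ _ (mk_linear F_A_lin)) => x /=.
  (* In [F (X *: x)] the term [j = 0] contains [f (X ^+ n *: x) = tau * f x], so it is [X] times the
     last term of [F x]; the other terms shift by one. *)
  rewrite /F big_ord_recl big_ord_recr /= scalerDr [RHS]addrC; congr (_ + _).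
    rewrite subn0 subnn mul1r scalerA -exprSr -phi_tau scale1r.
    have /= -> : f (phi tau *: (x : P i.+1)) = tau * f x := linearZ_LR f tau x.
    by rewrite rmorphM phi_tau exprS -mulrA.
  rewrite scaler_sumr; apply: eq_bigr => j _ /=.
  rewrite scalerA -exprSr /bump add1n -subSn ?subSS; last by rewrite ltn_ord.
  by rewrite exprS -mulrA.
have [x|G GE] := vR (mk_linear F_lin).
  rewrite /= /F big1 // => j _; rewrite -linearZ.
  have -> : f (d i.+1 (X ^+ (n' - j) *: x)) = 0 by exact: fd.
  by rewrite rmorph0 mulr0.
have g_lin : linear (fun x : res (P i) => co n' (G x) : A^o).
  by move=> a x y; rewrite resmodZ linearP; exact: co_lin.
exists (mk_linear g_lin) => x /=; rewrite -GE /= /F co_bigsum big_ord_recr /=.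
rewrite subnn scale1r mulrC coZ co_X // eqxx mulr1 big1 ?add0r // => j _.
by rewrite mulrC coZ co_X ?(ltnW (ltn_ord j)) // ?ltnS ?(ltnW (ltn_ord _)) // gtn_eqF ?mulr0.
Qed.

Section Filtration.
Hypothesis divXP : forall i, has_divX (P i).
Variable N : lmodType R.
Hypothesis XN0 : forall y : N, X *: y = 0.

(* The submodules [fil j] of [Hom_A (P i, N)] filter it, with successive quotients
   [fil 1 = Hom_R (P i, N)]. *)
Definition fil i (j : nat) (f : {linear res (P i) -> res N}) : Prop :=
  forall x : P i, f (X ^+ j *: x) = 0.

Definition fil_vanishes j i : Prop :=
  forall f : {linear res (P i.+1) -> res N}, fil j f ->
    (forall x, f (d i.+1 x) = 0) ->
  exists2 g : {linear res (P i) -> res N}, fil j g & forall x, f x = g (d i x).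

(** [X ^+ n] comes from [A], hence passes through [f], and it kills [N]; so the filtration ends at
    [n]. *)
Lemma fil_top i (f : {linear res (P i) -> res N}) : fil n f.
Proof.
move=> x; rewrite -phi_tau.
have -> : f (phi tau *: x) = phi tau *: (f x : N) by exact: linearZ_LR f tau x.
by rewrite phi_tau exprSr -scalerA XN0 scaler0.
Qed.

(** Precomposition with [X] maps [fil j.+1] onto [fil j]. The preimage is [f] after division by [X],
    whose error lies in the multiples of [X ^+ n'], killed by [f]. *)
Lemma fil_lift i j (f : {linear res (P i) -> res N}) : (j <= n')%N -> fil j f ->
  exists2 f' : {linear res (P i) -> res N},
    fil j.+1 f' & forall x : P i, f' (X *: x) = f x.
Proof.
move=> jn fj; have [sig sigE] := divXP i.
have fE (x : P i) : f (sig (X *: x)) = f x.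
  have [w ->] := sigE x; rewrite (linearD f) -(subnKC jn) exprD -scalerA.
  by rewrite (fj _) addr0.
by exists (f \o sig) => x /=; rewrite ?exprS -?scalerA fE.
Qed.

Lemma fil_lift_top i (f : {linear res (P i) -> res N}) : fil 1 f ->
  exists f' : {linear res (P i) -> res N}, forall x : P i, f' (X ^+ n' *: x) = f x.
Proof.
move=> f1; suff /(_ n' (leqnn _)) [f' _ f'E] : forall j, (j <= n')%N ->
    exists2 f' : {linear res (P i) -> res N},
      fil j.+1 f' & forall x : P i, f' (X ^+ j *: x) = f x by exists f'.
elim=> [_|j IH jn]; first by exists f => // x; rewrite scale1r.
have [f' f'j f'E] := IH (ltnW jn); have [f'' f''j f''E] := fil_lift jn f'j.
by exists f'' => // x; rewrite exprS -scalerA f''E f'E.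
Qed.

Definition compX i j (f : {linear res (P i) -> res N}) : {linear res (P i) -> res N} :=
  f \o res_linear phi (X ^+ j \*: idfun : {linear P i -> P i}).

(** As [X] kills [N], an [A]-linear map is [R]-linear exactly when it kills the multiples of [X]. *)
Lemma fil_vanishes1 i : fil_vanishes 1 i <-> vanishes P i N.
Proof.
have lin k (f : {linear res (P k) -> res N}) : fil 1 f -> linear (f : P k -> N).
  by move=> f1; apply: linear_generated => x; rewrite XN0 -[X]expr1 f1.
split=> [van f fd|van f f1 fd].
  have [x|//|g g1 gE] := van (res_linear phi f).
    by rewrite /= linearZ /= expr1 XN0.
  by exists (mk_linear (lin _ _ g1)).
have [|g gE] := van (mk_linear (lin _ _ f1)); first exact: fd.
by exists (res_linear phi g) => // x; rewrite /= linearZ /= expr1 XN0.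
Qed.

Lemma fil_vanishes_top i : fil_vanishes n i <-> vanishes PA i (res N).
Proof.
split=> van f => [fd|_ fd].
  by have [||g _ gE] := van f; [exact: fil_top | exact: fd | exists g].
by have [|g gE] := van f; [exact: fd | exists g => //; exact: fil_top].
Qed.

(** The exact sequence [0 -> fil 1 -> fil j.+1 -> fil j -> 0], whose surjection is precomposition
    with [X]. *)
Lemma fil_vanishesS i j : (j <= n')%N ->
  fil_vanishes 1 i -> fil_vanishes j i -> fil_vanishes j.+1 i.
Proof.
move=> jn van1 van f fj fd.
have [x|x|g gj gE] := van (compX 1 f).
- by rewrite /= expr1 scalerA -exprS fj.
- by rewrite /= -linearZ fd.
have [g' g'j g'E] := fil_lift jn gj.
have [x|x|h h1 hE] := van1 (f \- (g' \o res_linear phi (d i))).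
- by rewrite /= linearZ /= expr1 g'E -gE /= expr1 subrr.
- by rewrite /= fd res_dd (linear0 g') subrr.
exists (h \+ g') => x /=; last by rewrite -hE /= subrK.
by rewrite g'j {1}exprSr -scalerA -[X]expr1 scalerA mulrC -scalerA h1 add0r.
Qed.

Lemma vanishes_restrict i : vanishes P i N -> vanishes PA i (res N).
Proof.
move=> /fil_vanishes1 van1; apply/fil_vanishes_top.
suff vanj j : (j <= n)%N -> fil_vanishes j i by exact: vanj.
elim: j => [_|j IH jn].
  move=> f f0 _; exists \0 => // x.
  by have := f0 x; rewrite expr0 scale1r.
exact: fil_vanishesS van1 (IH (ltnW jn)).
Qed.

(* [H^i (fil 1)] and [H^i.+2 (fil 1)] are both isomorphic to the cohomology of
   [fil n'] when that of [fil n] vanishes. *)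
Lemma vanishes_period i : vanishes PA i (res N) -> vanishes PA i.+1 (res N) ->
  vanishes P i.+2 N -> vanishes P i N.
Proof.
move=> /fil_vanishes_top van /fil_vanishes_top vanS /fil_vanishes1 van1.
apply/fil_vanishes1.
(* First the sequence [0 -> fil 1 -> fil n -> fil n' -> 0] given by [X]. *)
have van' : fil_vanishes n' i.+1.
  move=> f fj fd; have [f' f'j f'E] := fil_lift (leqnn n') fj.
  have [x|x|h h1 hE] := van1 (f' \o res_linear phi (d i.+2)).
  - by rewrite /= linearZ /= expr1 f'E fd.
  - by rewrite /= res_dd (linear0 f').
  have [x|g _ gE] := vanS (f' \- h) (fil_top _).
    by rewrite /= -hE subrr.
  exists (compX 1 g) => x /=.
    by rewrite expr1 scalerA -exprS fil_top.
  rewrite -f'E -linearZ -gE /= expr1.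
  by have := h1 x; rewrite expr1 => ->; rewrite subr0.
(* Then [0 -> fil n' -> fil n -> fil 1 -> 0], given by [X ^+ n']. *)
move=> f f1 fd; have [f' f'E] := fil_lift_top f1.
have [x|x|h hn hE] := van' (f' \o res_linear phi (d i.+1)).
- by rewrite /= linearZ /= f'E fd.
- by rewrite /= res_dd (linear0 f').
have [x|g _ gE] := van (f' \- h) (fil_top _); first by rewrite /= -hE subrr.
exists (compX n' g) => x /=; first by rewrite expr1 scalerA -exprSr fil_top.
by rewrite -f'E -linearZ -gE /= hn subr0.
Qed.

End Filtration.

End Transfer.
End Extension.

(** * Adic completeness and a Nakayama argument on cocycles *)

Section Complete.
Variables (R : comNzRingType) (X : R).

(* Completeness without limits: [s j] plays the role of [\sum_k X^k u (j + k)]. *)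
Definition adic_complete (V : lmodType R) : Prop :=
  forall u : nat -> V, exists s : nat -> V, forall j, s j = u j + X *: s j.+1.

(** This makes the sums of [adic_complete] unique. When [X] is injective on [V], it says that the
    submodules of multiples of [X ^+ j] intersect in zero. *)
Definition adic_separated (V : lmodType R) : Prop :=
  forall s : nat -> V, (forall j, s j = X *: s j.+1) -> forall j, s j = 0.

Variables (M V : lmodType R) (P : projective_resolution M).
Hypothesis V_complete : adic_complete V.
Hypothesis V_separated : adic_separated V.

Lemma adic_sum_unique (s s' u : nat -> V) :
    (forall j, s j = u j + X *: s j.+1) -> (forall j, s' j = u j + X *: s' j.+1) ->
  s =1 s'.
Proof.
move=> sE s'E j; apply/eqP; rewrite -subr_eq0; apply/eqP; move: j.
apply: V_separated => j; rewrite {1}sE {1}s'E.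
by rewrite opprD addrACA subrr add0r scalerBr.
Qed.

Lemma linear_adic_sum (U : lmodType R) (g : nat -> {linear U -> V}) :
  exists s : nat -> {linear U -> V}, forall j x, s j x = g j x + X *: s j.+1 x.
Proof.
pose s x := sval (cid (V_complete (fun j => g j x))).
have sE x j : s x j = g j x + X *: s x j.+1 by rewrite /s; case: cid.
have s_lin j : linear (s^~ j).
  move=> a x y; apply: (adic_sum_unique (sE _)
    (s' := fun j => a *: s x j + s y j)) => {}j.
  by rewrite (sE x j) (sE y j) linearP !scalerDr addrACA !scalerA [a * X]mulrC.
by exists (fun j => mk_linear (s_lin j)) => j x; exact: sE.
Qed.

(* Nakayama: if [X] acts surjectively on cohomology then cocycles are coboundaries
   up to [X^j] for all [j]. *)
Lemma complete_vanishes i :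
    (forall f : {linear P i.+1 -> V}, (forall x, f (res_diff P i.+1 x) = 0) ->
      exists (f' : {linear P i.+1 -> V}) (g : {linear P i -> V}),
        (forall x, f' (res_diff P i.+1 x) = 0) /\
        (forall x, f x = X *: f' x + g (res_diff P i x))) ->
  vanishes P i V.
Proof.
move=> X_surj f fd.
pose cocycle := {f : {linear P i.+1 -> V} | forall x, f (res_diff P i.+1 x) = 0}.
have step (c : cocycle) : exists c' : cocycle * {linear P i -> V},
    forall x, sval c x = X *: sval c'.1 x + c'.2 (res_diff P i x).
  case: c => h hd; have [h' [g [h'd hE]]] := X_surj h hd.
  by exists (exist _ h' h'd, g).
pose F := nat_rect (fun=> cocycle) (exist _ f fd) (fun _ c => (sval (cid (step c))).1).
pose G j := (sval (cid (step (F j)))).2.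
have FE j x : sval (F j) x = X *: sval (F j.+1) x + G j (res_diff P i x).
  by rewrite /G /=; case: cid.
have [s sE] := linear_adic_sum G.
(* [s 0] plays the role of the sum of the [X ^+ j *: G j]. The differences [F j - s j d] are
   successive quotients by [X], hence zero by separation. *)
exists (s 0) => x; apply/eqP; rewrite -subr_eq0; apply/eqP.
apply: (V_separated (s := fun j => sval (F j) x - s j (res_diff P i x))) 0%N => j.
by rewrite FE sE [X *: _ + _]addrC opprD addrACA subrr add0r scalerBr.
Qed.

End Complete.

(** * Passing from a module to its first syzygy *)

Section Syzygy.
Variables (R : comNzRingType) (M : lmodType R) (P : projective_resolution M).

Fact syzygy0 : res_aug P 0 = 0.
Proof. exact: linear0. Qed.
Fact syzygyP a x y : res_aug P x = 0 -> res_aug P y = 0 -> res_aug P (a *: x + y) = 0.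
Proof. by move=> x0 y0; rewrite linearP x0 y0 scaler0 addr0. Qed.
Definition syzygy : submodule (P 0) := Submodule syzygy0 syzygyP.
Local Notation Z := (submod_type syzygy).

Definition shift_aug (x : P 1) : Z := @submod_elt _ _ syzygy _ (res_augd x).

Fact shift_aug_is_linear : linear shift_aug.
Proof. by move=> a x y; apply: val_inj; exact: linearP. Qed.

Fact shift_aug_surj z : exists x, mk_linear shift_aug_is_linear x = z.
Proof.
have /res_exact0[x xz] := submod_valU z.
by exists x; apply: val_inj.
Qed.

Fact shift_exact0 x : mk_linear shift_aug_is_linear x = 0 <->
  exists y, res_diff P 1 y = x.
Proof.
rewrite -res_exactS; split=> [/(congr1 val)//|x0].
exact: val_inj.
Qed.

Definition shift_resolution : projective_resolution Z :=
  @ProjectiveResolution R Z (fun i => P i.+1) (fun i => res_diff P i.+1)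
    (mk_linear shift_aug_is_linear) (fun i => @res_projective _ _ P i.+1)
    shift_aug_surj shift_exact0 (fun i => @res_exactS _ _ P i.+1).

Let syzygy_incl : {linear Z -> P 0} := @submod_val _ _ syzygy.

Let syzygy_exact y : res_aug P y = 0 -> exists x, syzygy_incl x = y.
Proof. by move=> y0; exists (@submod_elt _ _ syzygy _ y0). Qed.

(** The syzygy replaces [M] in both arguments, and the two degree shifts cancel: cohomology on
    [shift_resolution] is that on [P] one degree higher, and the connecting map to [Z] raises the
    degree by one. *)
Lemma vanishes_syzygy i : vanishes P i.+1 (P 0) -> vanishes P i M ->
  vanishes shift_resolution i Z.
Proof.
move=> v0 vM; exact: (vanishes_sub (io := syzygy_incl) val_inj (res_aug_surj P)
  (@submod_valU _ _ _) syzygy_exact vM v0).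
Qed.

Lemma syzygy_vanishes i : vanishes P i (P 0) -> vanishes shift_resolution i Z ->
  vanishes P i M.
Proof.
exact: (vanishes_quot (io := syzygy_incl) val_inj (res_aug_surj P)
  (@submod_valU _ _ _) syzygy_exact).
Qed.

End Syzygy.

Definition submodule_generated (R : comNzRingType) (V : lmodType R)
    (U : submodule V) : Prop :=
  exists (q : nat) (e : 'I_q -> V), (forall i, U (e i)) /\
    forall x, U x -> exists c : 'I_q -> R, x = \sum_i c i *: e i.

(** * The case of a module on which [X] is regular *)

Section Extension.
Variables (A R : comNzRingType) (phi : {rmorphism A -> R}).
Variables (X : R) (n' : nat) (tau : A) (co : nat -> R -> A).
Local Notation n := n'.+1.
Hypothesis co_lin : forall i a r s, co i (phi a * r + s) = a * co i r + co i s.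
Hypothesis co_X : forall i j, (i < n)%N -> (j < n)%N -> co i (X ^+ j) = (i == j)%:R.
Hypothesis co_sum : forall r, r = \sum_(i < n) phi (co i r) * X ^+ i.
Hypothesis phi_tau : phi tau = X ^+ n.
Local Notation res := (resmod phi).

Section TorsionFree.
Variables (M : lmodType R) (P : projective_resolution M) (p : nat -> nat).
Hypothesis P_basis : forall i, dual_basis 'I_(p i) (P i).
Hypothesis P0_noeth : forall U : submodule (P 0), submodule_generated U.
Hypothesis X_inj : forall y : M, X *: y = 0 -> y = 0.
Hypothesis M_complete : adic_complete X M.
Hypothesis M_separated : adic_separated X M.

Fact XM0 : exists y : M, 0 = X *: y.
Proof. by exists 0; rewrite scaler0. Qed.
Fact XMP a (u v : M) : (exists y : M, u = X *: y) -> (exists y : M, v = X *: y) ->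
  exists y : M, a *: u + v = X *: y.
Proof.
move=> [y ->] [z ->]; exists (a *: y + z).
by rewrite scalerDr !scalerA mulrC.
Qed.
Let XM : submodule M := Submodule XM0 XMP.
Let N := submod_quot XM.
Let piN : {linear M -> N} := @submod_pi _ _ XM.
Let mulX : {linear M -> M} := X \*: idfun.

Let piN_surj z : exists y, piN y = z.
Proof.
exists (repr (z : Quotient.quot (submod_pred XM : zmodClosed M))).
exact: submod_pi_repr.
Qed.

Let piN_mulX y : piN (mulX y) = 0.
Proof. by rewrite -(linear0 piN); apply/submod_pi_eq; exists y; rewrite subr0. Qed.

Let piN_exact y : piN y = 0 -> exists x, mulX x = y.
Proof. by rewrite -(linear0 piN) => /submod_pi_eq[x]; rewrite subr0 => ->; exists x. Qed.

Let mulX_inj : injective mulX.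
Proof.
move=> x y /= /eqP; rewrite -subr_eq0 -scalerBr => /eqP/X_inj/eqP.
by rewrite subr_eq0 => /eqP.
Qed.

Let XN0 (y : N) : X *: y = 0.
Proof. by have [x <-] := piN_surj y; rewrite -linearZ piN_mulX. Qed.

Let projA i : projective (res (P i)).
Proof. exact: dual_basis_projective (dual_basis_res co_lin co_sum (P_basis i)). Qed.

Local Notation PA := (res_resolution projA).
Let xi i : {linear PA i -> PA i} := res_linear phi (X \*: idfun : {linear P i -> P i}).
Let xi_d i x : res_diff PA i (xi i.+1 x) = xi i (res_diff PA i x).
Proof. by rewrite /= linearZ. Qed.
Let xi_aug x : res_aug PA (xi 0 x) = res_linear phi mulX (res_aug PA x).
Proof. by rewrite /= linearZ. Qed.

Let Z := cone_syzygy PA (res_linear phi mulX).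

(** [Z] is also stable under [R], so it has finitely many generators over [R]; their multiples by
    [1, X, ..., X ^+ n'] generate it over [A]. *)
Fact cone_generated : finitely_generated (submod_type Z).
Proof.
have Z0 : Z (0 : P 0) := submod0 Z.
have ZP a (u v : P 0) : Z u -> Z v -> Z (a *: u + v).
  by move=> [y yE] [z zE]; exists (a *: y + z);
     have /= -> := linearP (res_aug P) a u v; move: yE zE => /= -> ->;
     rewrite scalerDr !scalerA mulrC.
have [q [e [Ze gen]]] := P0_noeth (@Submodule R (P 0) Z Z0 ZP).
have Zeij (k : 'I_q * 'I_n) : Z (X ^+ k.2 *: e k.1 : P 0).
  by rewrite -[_ *: _]addr0; exact: (ZP _ _ _ (Ze k.1) Z0).
apply: (fin_generated (e := fun k => submod_elt (Zeij k))) => z.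
have [c cE] := gen _ (submod_valU z).
exists (fun k : 'I_q * 'I_n => co k.2 (c k.1)); apply: val_inj; rewrite raddf_sum /=.
rewrite -(pair_bigA _ (fun i (j : 'I_n) => co j (c i) *: (X ^+ j *: e i : res (P 0)))) /=.
rewrite [LHS]cE; apply: eq_bigr => i _; rewrite {1}[c i]co_sum scaler_suml.
by apply: eq_bigr => j _; rewrite resmodZ scalerA.
Qed.

Lemma torsionfree_vanishes c : SAC A ->
    (forall i, vanishes P i R^o) -> (forall i, (c <= i)%N -> vanishes P i M) ->
  forall i, vanishes P i M.
Proof.
move=> sacA vR vM.
have vN i : (c <= i)%N -> vanishes P i N.
  by move=> ci; apply: (vanishes_quot mulX_inj piN_surj piN_mulX piN_exact);
     apply: vM => //; exact: leqW.
have divXP i := dual_basis_divX co_lin co_X co_sum phi_tau (P_basis i).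
have vAA i : vanishes PA i A^o by exact: (vanishes_frobenius co_lin co_X co_sum phi_tau (vR i)).
have vP0 i : vanishes PA i (res (P 0)).
  exact: (dual_basis_vanishes (dual_basis_res co_lin co_sum (P_basis 0%N)) (vAA i)).
have vNA i : (c <= i)%N -> vanishes PA i (res N).
  by move=> /vN vNi; exact: (vanishes_restrict co_sum phi_tau divXP XN0 vNi).
(* The sequence [Z -> P 0 -> N] over [A]; the cohomology with values in its middle term vanishes by
   [vP0]. *)
pose io : {linear submod_type Z -> res (P 0)} := @submod_val _ _ Z.
pose pi : {linear res (P 0) -> res N} := res_linear phi (piN \o res_aug P).
have pi_surj z : exists y, pi y = z.
  by have [x xz] := piN_surj z; have [y yx] := res_aug_surj P x;
     exists y; rewrite /= yx.
have pi_io y : pi (io y) = 0.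
  by have [x /= xE] := submod_valU y; rewrite /= xE; exact: piN_mulX.
have pi_exact y : pi y = 0 -> exists x, io x = y.
  move=> /piN_exact[x xE]; have Zy : Z y by exists x.
  by exists (submod_elt Zy).
have vZ : exists c, forall i, (c <= i)%N -> vanishes PA i (submod_type Z).
  exists c.+1 => -[//|i ci].
  exact: (vanishes_sub val_inj pi_surj pi_io pi_exact (vNA i ci) (vP0 _)).
have vNall i : vanishes PA i (res N).
  apply: (xi_nilpotent_vanishes (xi := xi) (n := n) xi_d) => [f x|].
    suff -> : iter n (xi i.+1) x = X ^+ n *: (x : P i.+1) by exact: (fil_top phi_tau XN0 f x).
    elim: (n) => [|j IH]; first by rewrite scale1r.
    by rewrite iterS IH /= scalerA exprS.
  apply: (xi_surjective_quot xi_d val_inj pi_surj pi_io pi_exact) => //.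
  exact: (SAC_xi_surjective xi_d xi_aug mulX_inj sacA cone_generated).
have {}vN i : vanishes P i N.
  (* Downward induction in steps of two, since [vanishes_period] lowers the degree by two; [k = c]
     covers every [i]. *)
  suff vNk k : forall i, (c <= i + k.*2)%N -> vanishes P i N.
    by apply: (vNk c); rewrite -addnn addnA leq_addl.
  elim: k => [|k IH] j; first by rewrite addn0; exact: vN.
  rewrite doubleS -!addSnnS => /IH vNj.
  exact: (vanishes_period co_sum phi_tau divXP XN0 (vNall _) (vNall _) vNj).
move=> i; apply: (complete_vanishes M_complete M_separated) => f fd.
(* Modulo [X] the cocycle bounds some [g]. After subtracting a lift of [g] it is divisible by [X],
   and the quotient is again a cocycle. *)
have [x|g gE] := vN i (piN \o f); first by rewrite /= fd linear0.
have [g' g'E] : exists g' : {linear P i -> M}, forall x, piN (g' x) = g x.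
  exact: projective_lift (@res_projective _ _ P i) _.
have [x|f' f'E] := projective_lift (g := mulX) (f := f \- (g' \o res_diff P i))
  (@res_projective _ _ P i.+1).
  by apply: piN_exact; rewrite [X in piN X]/= linearB g'E -gE; exact: subrr.
exists f', g'; split=> x.
  by apply: mulX_inj; rewrite f'E /= fd res_dd !linear0 addr0.
by have /= -> := f'E x; rewrite subrK.
Qed.

End TorsionFree.
End Extension.

(** * Resolutions by finite free modules *)

Section FreeResolution.
Variable R : comNzRingType.
Hypothesis R_noeth : forall p (U : submodule 'rV[R]_p), submodule_generated U.

Lemma kernel_matrix p (M : lmodType R) (f : {linear 'rV[R]_p -> M}) :
  exists (q : nat) (D : 'M[R]_(q, p)), forall u, f u = 0 <-> exists v, v *m D = u.
Proof.
have ker0 : f 0 = 0 := linear0 f.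
have kerP a u v : f u = 0 -> f v = 0 -> f (a *: u + v) = 0.
  by move=> fu fv; rewrite linearP fu fv scaler0 addr0.
have [q [e [fe gen]]] := R_noeth (Submodule ker0 kerP).
exists q, (\matrix_i e i) => u; split=> [/gen[c ->]|[v <-]].
  exists (\row_i c i); rewrite mulmx_sum_row.
  by apply: eq_bigr => i _; rewrite mxE rowK.
rewrite mulmx_sum_row linear_sum big1 // => i _.
by rewrite linearZ_LR rowK (fe i : f (e i) = 0) scaler0.
Qed.

(** The terms are equal to row spaces as modules, so properties of ['rV[R]_p] transfer by
    rewriting. *)
Lemma free_resolution (M : lmodType R) : finitely_generated M ->
  exists (P : projective_resolution M) (p : nat -> nat),
    forall i, P i = 'rV[R]_(p i) :> lmodType R.
Proof.
move=> [d [e gen]].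
have aug_lin : linear (fun v : 'rV[R]_d => \sum_i v 0 i *: e i).
  move=> a u v; rewrite scaler_sumr -big_split; apply: eq_bigr => i _.
  by rewrite !mxE scalerDl scalerA.
(* The state of the recursion is a matrix packed with its two sizes; the next matrix has the kernel
   of the current one as its row space. *)
pose mx := {q & {p & 'M[R]_(p, q)}}.
pose next_p (s : mx) := kernel_matrix (mulmxr (projT2 (projT2 s)) : {linear 'rV_ _ -> 'rV_ _}).
pose next (s : mx) : mx :=
  existT _ (projT1 (projT2 s)) (existT _ _ (sval (cid (svalP (cid (next_p s)))))).
have nextE (s : mx) (u : 'rV_ _) : u *m projT2 (projT2 s) = 0 <->
    exists v : 'rV_ _, v *m projT2 (projT2 (next s)) = u.
  exact: (svalP (cid (svalP (cid (next_p s)))) u).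
have [p0 [D0 D0E]] := kernel_matrix (mk_linear aug_lin).
pose st i : mx := iter i next (existT _ d (existT _ p0 D0)).
have aug_surj x : exists v, mk_linear aug_lin v = x.
  have [c ->] := gen x; exists (\row_i c i).
  by apply: eq_bigr => i _; rewrite mxE.
pose diff i : {linear 'rV[R]_(projT1 (st i.+1)) -> 'rV[R]_(projT1 (st i))} :=
  mulmxr (projT2 (projT2 (st i))) : {linear 'rV_ _ -> 'rV_ _}.
pose P := @ProjectiveResolution R M (fun i => 'rV[R]_(projT1 (st i))) diff
  (mk_linear aug_lin) (fun i => dual_basis_projective (dual_basis_rV R _))
  aug_surj D0E (fun i => nextE (st i)).
by exists P, (fun i => projT1 (st i)).
Qed.

End FreeResolution.

Section CompleteModules.
Variables (R : comNzRingType) (X : R).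

Lemma adic_complete_rV p : adic_complete X R^o -> adic_complete X 'rV[R]_p.
Proof.
move=> cR u; pose s j := sval (cid (cR (fun i => u i 0 j))).
have sE j i : s j i = u i 0 j + X * s j i.+1.
  exact: (svalP (cid (cR (fun i => u i 0 j))) i).
by exists (fun i => \row_j s j i) => i; apply/rowP => j; rewrite !mxE sE.
Qed.

Lemma adic_separated_rV p : adic_separated X R^o -> adic_separated X 'rV[R]_p.
Proof.
move=> sR s sE i; apply/rowP => j; rewrite mxE.
by apply: (sR (fun i => s i 0 j)) => {}i; rewrite {1}sE !mxE.
Qed.

Lemma adic_complete_surj (U V : lmodType R) (f : {linear U -> V}) :
  (forall y, exists x, f x = y) -> adic_complete X U -> adic_complete X V.
Proof.
move=> f_surj cU u.
pose u' j := sval (cid (f_surj (u j))).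
have u'E j : f (u' j) = u j by rewrite /u'; case: cid.
have [s sE] := cU u'; exists (f \o s) => j.
by rewrite /= {1}sE linearD linearZ u'E.
Qed.

Lemma adic_separated_inj (U V : lmodType R) (f : {linear U -> V}) :
  injective f -> adic_separated X V -> adic_separated X U.
Proof.
move=> f_inj sV s sE j; apply: f_inj; rewrite linear0.
by apply: (sV (f \o s)) => {}j; rewrite /= {1}sE linearZ.
Qed.

End CompleteModules.

(** * Ascent of (SAC) along a free extension *)

Section SACExtension.
Variables (A R : comNzRingType) (phi : {rmorphism A -> R}).
Variables (X : R) (n' : nat) (tau : A) (co : nat -> R -> A).
Local Notation n := n'.+1.
Hypothesis co_lin : forall i a r s, co i (phi a * r + s) = a * co i r + co i s.
Hypothesis co_X : forall i j, (i < n)%N -> (j < n)%N -> co i (X ^+ j) = (i == j)%:R.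
Hypothesis co_sum : forall r, r = \sum_(i < n) phi (co i r) * X ^+ i.
Hypothesis phi_tau : phi tau = X ^+ n.
Hypothesis R_noeth : forall p (U : submodule 'rV[R]_p), submodule_generated U.
Hypothesis X_reg : forall r : R, X * r = 0 -> r = 0.
Hypothesis R_complete : adic_complete X R^o.
Hypothesis R_separated : adic_separated X R^o.

Theorem SAC_extension : SAC A -> SAC R.
Proof.
move=> sacA M fgM vR [c vM] [//|i] _.
have [P [p PE]] := free_resolution R_noeth fgM.
have P_basis j : dual_basis 'I_(p j) (P j) by rewrite PE; exact: dual_basis_rV.
(* [P 1] is the degree 0 term of the shifted resolution used below. *)
have P1_noeth (U : submodule (P 1)) : submodule_generated U.
  by move: (P 1) (PE 1%N) U => V -> U; exact: R_noeth.
have {}vR j : vanishes P j R^o by apply/ext_vanishesP/vR.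
have vP0 j : vanishes P j (P 0) by exact: (dual_basis_vanishes (P_basis 0%N) (vR j)).
have {}vM j : (c <= j)%N -> vanishes P j M.
  by move=> cj; apply/ext_vanishesP/vM; exact: leqW.
pose incl : {linear submod_type (syzygy P) -> P 0} := @submod_val _ _ (syzygy P).
have incl_inj : injective incl by exact: val_inj.
have X_inj y : X *: y = 0 :> submod_type (syzygy P) -> y = 0.
  move=> Xy; apply: incl_inj; rewrite linear0.
  have : X *: incl y = 0 by rewrite -linearZ Xy linear0.
  move: (incl y); move: (P 0) (PE 0%N) => V -> v Xv; apply/rowP => j.
  by rewrite mxE; apply: X_reg; move/rowP: Xv => /(_ j); rewrite !mxE.
(* The syzygy is a quotient of [P 1], hence complete, and a submodule of [P 0], hence separated. *)
have complete : adic_complete X (submod_type (syzygy P)).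
  apply: (adic_complete_surj (res_aug_surj (shift_resolution P))).
  by rewrite /= PE; exact: adic_complete_rV.
have separated : adic_separated X (submod_type (syzygy P)).
  by apply: (adic_separated_inj incl_inj); rewrite PE; exact: adic_separated_rV.
apply/(ext_vanishesP _ P); apply: (syzygy_vanishes (vP0 i)).
have vZ j : (c <= j)%N ->
    vanishes (shift_resolution P) j (submod_type (syzygy P)).
  by move=> /vM; exact: vanishes_syzygy.
exact: (torsionfree_vanishes (P := shift_resolution P) co_lin co_X co_sum phi_tau
  (fun j => P_basis j.+1) P1_noeth X_inj complete separated sacA
  (fun j => vR j.+1) vZ).
Qed.

End SACExtension.

(** * Semigroup rings: completeness and Noetherianity *)

Section SemigroupRing.
Variables (k : fieldType) (S : natSubmonoid) (m : nat).
Hypothesis Sm : S m.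
Local Notation R := (sgring k S).
Local Notation X := (sg_Xn k Sm : R).
Implicit Types a b : R.

Lemma sm_mul (q : nat) : S (q * m)%N.
Proof. by elim: q => [|q IH]; [exact: sm0 | rewrite mulSn; exact: smD]. Qed.

Lemma sgringE a b : (forall i, a i = b i) -> a = b.
Proof. by move=> ab; apply: val_inj; exact: fpsP. Qed.

Lemma sgring_notin a i : ~ S i -> a i = 0.
Proof.
move=> nSi; apply/eqP; apply: contra_notT nSi => ai.
by have /sgring_predP := sgringP a; apply.
Qed.

Definition sgring_of (f : nat -> k) (fS : forall i, f i != 0 -> S i) : R :=
  SGRing (introT (sgring_predP S (FPS f)) fS).

Lemma sg_addE a b i : (a + b) i = a i + b i. Proof. by []. Qed.
Lemma sg_mulE a b i : (a * b) i = \sum_(j < i.+1) a j * b (i - j)%N.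
Proof. by []. Qed.

Lemma sg_sumE (I : finType) (F : I -> R) i : (\sum_j F j) i = \sum_j F j i.
Proof. exact: (big_morph (fun a : R => a i) (fun _ _ => erefl) erefl). Qed.

Lemma sg_XM a i : (X * a) i = if (m <= i)%N then a (i - m)%N else 0.
Proof.
rewrite sg_mulE; case: leqP => mi; last first.
  rewrite big1 // => j _; rewrite /= (_ : _ == _ = false) ?mul0r //.
  by apply/negbTE; rewrite neq_ltn (leq_trans _ mi).
have mi1 : (m < i.+1)%N by rewrite ltnS.
rewrite (bigD1 (Ordinal mi1)) //= eqxx mul1r big1 ?addr0 // => j jm.
by rewrite -[m]/(val (Ordinal mi1)) (inj_eq val_inj) (negPf jm) mul0r.
Qed.

Lemma sg_XnM q a i : (X ^+ q * a) i = if (q * m <= i)%N then a (i - q * m)%N else 0.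
Proof.
elim: q i => [|q IH] i; first by rewrite expr0 mul1r subn0.
rewrite exprS -mulrA sg_XM mulSn; case: leqP => mi; last first.
  by case: leqP => // /(leq_trans (leq_addr _ _)); rewrite leqNgt mi.
by rewrite IH leq_subRL // subnDA.
Qed.

Lemma sg_X_reg a : X * a = 0 -> a = 0.
Proof.
move=> Xa; apply: sgringE => i.
by have := sg_XM a (i + m); rewrite Xa leq_addl addnK => <-.
Qed.

Hypothesis m_gt0 : (0 < m)%N.

Lemma sg_XnE q i : (X ^+ q) i = (i == q * m)%N%:R.
Proof.
rewrite -[X ^+ q]mulr1 sg_XnM; case: leqP => qi.
  by rewrite /= -[_ == _]/(i - q * m == 0)%N subn_eq0 [in RHS]eqn_leq qi andbT.
by rewrite ltn_eqF.
Qed.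

Lemma sgring_complete : adic_complete X R^o.
Proof.
move=> u.
(* The coefficient at [i] of the sum of the [X ^+ N * u (j + N)], to which only [N <= i %/ m]
   contribute. *)
pose s j i := \sum_(N < (i %/ m).+1) (u (j + N)%N : R) (i - N * m)%N.
have sS j i : s j i != 0 -> S i.
  move=> sji; apply: contrapT => nSi; move/eqP: sji; apply.
  rewrite /s big1 // => N _; apply: sgring_notin => SiN; apply: nSi.
  have NmI : (N * m <= i)%N.
    by apply: leq_trans (leq_trunc_div i m); rewrite leq_mul2r -ltnS ltn_ord orbT.
  by rewrite -(subnK NmI); apply: smD => //; exact: sm_mul.
exists (fun j => sgring_of (sS j)) => j; apply: sgringE => i.
rewrite sg_addE [in RHS]sg_XM /= /s big_ord_recl /= addn0 subn0; congr (_ + _).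
case: leqP => mi; last by rewrite divn_small // big_ord0.
have -> : (i %/ m = ((i - m) %/ m).+1)%N.
  by rewrite -{1}(subnK mi) divnDr // divnn m_gt0 addn1.
by apply: eq_bigr => N _; rewrite /bump add1n addSnnS mulSn subnDA.
Qed.

Lemma sgring_separated : adic_separated X R^o.
Proof.
move=> s sE j; apply: sgringE => i.
elim/ltn_ind: i j => i IH j; rewrite sE sg_XM; case: leqP => // mi.
by apply: IH; rewrite ltn_subrL m_gt0 (leq_trans m_gt0).
Qed.

Definition sg_cst (c : k) : R.
Proof.
refine (@sgring_of (fun i => if i == 0%N then c else 0) _) => -[_|i].
  exact: sm0.
by rewrite eqxx.
Defined.

Lemma sg_cstM c a i : (sg_cst c * a) i = c * a i.
Proof.
rewrite sg_mulE big_ord_recl /= subn0 big1 ?addr0 // => j _.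
by rewrite mul0r.
Qed.

Section Noetherian.
Variables (p' : nat) (U : submodule 'rV[R]_(p'.+1)).
Local Notation p := p'.+1.
Local Notation e := (m * p)%N.
Implicit Types r : 'I_e.

(* Interleaving the [p] coordinates turns a vector of series into one series, on
   which [X] acts as a shift by [e]. *)
Definition interleave (u : 'rV[R]_p) (i : nat) : k := u 0 (inord (i %% p)) (i %/ p)%N.
Local Notation cf := interleave.

Lemma interleaveB u v i : cf (u - v) i = cf u i - cf v i.
Proof. by rewrite /cf !mxE. Qed.

Lemma interleaveZ c u i : cf (sg_cst c *: u) i = c * cf u i.
Proof. by rewrite /cf mxE sg_cstM. Qed.

Lemma interleave_X q u i :
  cf (X ^+ q *: u) i = if (q * e <= i)%N then cf u (i - q * e)%N else 0.
Proof.
rewrite /cf mxE sg_XnM mulnA leq_divRL //; case: leqP => // qi.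
have -> : i = (q * m * p + (i - q * m * p))%N by rewrite subnKC.
by rewrite modnMDl divnMDl // !addKn.
Qed.

Lemma interleave_eq0 u : (forall i, cf u i = 0) -> u = 0.
Proof.
move=> u0; apply/rowP => l; apply: sgringE => i; rewrite mxE.
have := u0 (i * p + l)%N; rewrite /cf modnMDl divnMDl // divn_small // addn0.
by rewrite modn_small // inord_val.
Qed.

(** The order of [u] is at least [v]; the coefficient at [v] itself may be zero. *)
Definition leads u v : Prop := forall i, (i < v)%N -> cf u i = 0.

(* In each residue class of exponents modulo [e], an element of [U] of least
   possible order [v], if there is any. *)
Lemma exists_leader r : exists (f : 'rV[R]_p) (v : nat),
  [/\ U f, leads f v, (v %% e)%N = r &
    forall g w, U g -> leads g w -> (w %% e)%N = r -> cf g w != 0 ->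
      cf f v = 1 /\ (v <= w)%N].
Proof.
pose good w := exists g, [/\ U g, leads g w, (w %% e)%N = r & cf g w != 0].
have [[w0 /asboolP gw0]|none] := pselect (exists w, `[< good w >]); last first.
  (* An empty class gets the zero vector, with [v = r] to keep the congruence; the last clause is
     then vacuous. *)
  exists 0, r; split=> [||| g w Ug gw wr gw0].
  - exact: submod0.
  - by move=> i _; rewrite /cf mxE.
  - by rewrite modn_small.
  - by case: none; exists w; apply/asboolP; exists g.
have ex_good : exists w, `[< good w >] by exists w0; apply/asboolP.
case: (ex_minnP ex_good) => v /asboolP[g [Ug gv vr gv0]] v_min.
exists (sg_cst (cf g v)^-1 *: g), v; split=> [|i iv|//|g' w Ug' g'w wr g'w0].
- by rewrite -[_ *: _]addr0; apply: submodP => //; exact: submod0.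
- by rewrite interleaveZ (gv i iv) mulr0.
- split; first by rewrite interleaveZ mulVf.
  by apply: v_min; apply/asboolP; exists g'.
Qed.

(** Division by the leaders: at stage [j] the coefficient at [j] is cancelled by a scalar times a
    power of [X] times the leader of the class of [j]. The multipliers of each leader add up to a
    power series in [X]. *)
Lemma sgring_submodule_generated : submodule_generated U.
Proof.
have e_gt0 : (0 < e)%N by rewrite muln_gt0 m_gt0.
have [f /choice[v fvP]] := choice exists_leader.
exists e, f; split=> [i|g Ug]; first by case: (fvP i).
pose rj j : 'I_e := Ordinal (ltn_pmod j e_gt0).
(* If [j < v (rj j)] the truncated difference is a junk value, harmless because [c j] is then 0. *)
pose qj j := ((j - v (rj j)) %/ e)%N.
pose G := fix G j := if j is j'.+1 then
  G j' - (sg_cst (cf (G j') j') * X ^+ qj j') *: f (rj j') else g.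
pose c j := cf (G j) j.
have jE j : leads (G j) j -> U (G j) -> c j != 0 ->
    cf (f (rj j)) (v (rj j)) = 1 /\ j = (qj j * e + v (rj j))%N.
  move=> Gj UGj cj; case: (fvP (rj j)) => _ _ vr /(_ (G j) j).
  case=> // fv1 vj; split=> //; rewrite /qj divnK ?subnK //.
  by rewrite -eqn_mod_dvd // vr.
have GP j : U (G j) /\ leads (G j) j.
  elim: j => [|j [UGj Gj]]; first by [].
  have [Uf fv _ _] := fvP (rj j); split.
    by rewrite /= addrC -scaleNr; apply: submodP.
  move=> i; rewrite ltnS leq_eqVlt /= interleaveB -scalerA interleaveZ -/(c j).
  have [cj|cj] := eqVneq (c j) 0.
    by rewrite cj mul0r subr0 => /orP[/eqP->|/Gj].
  have [fv1 jq] := jE j Gj UGj cj; rewrite interleave_X.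
  case/orP=> [/eqP->|ij].
    have -> : (qj j * e <= j)%N by rewrite [leqRHS]jq leq_addr.
    have -> : (j - qj j * e)%N = v (rj j) by rewrite {1}jq addKn.
    by rewrite fv1 mulr1 subrr.
  rewrite Gj //; case: leqP => qi; rewrite ?fv ?mulr0 ?subr0 //.
  by rewrite ltn_subLR // -jq.
(* [T j r] collects the multiplier of [f r] from stage [j] on: its term in [X ^+ q], at exponent
   [q * m], is the one used at stage [v r + q * e]. *)
pose w r i := (v r + (i %/ m) * e)%N.
pose tail j r i := if (m %| i)%N && (j <= w r i)%N then c (w r i) else 0.
have tailS j r i : tail j r i != 0 -> S i.
  rewrite /tail; case: ifP => [/andP[/dvdnP[t ->] _] _|_]; last by rewrite eqxx.
  exact: sm_mul.
pose T j r := sgring_of (@tailS j r).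
have TS j r : T j r = T j.+1 r + (if r == rj j then sg_cst (c j) * X ^+ qj j else 0).
  apply: sgringE => i; rewrite sg_addE.
  have -> : (if r == rj j then sg_cst (c j) * X ^+ qj j else 0 : R) i =
            if (r == rj j) && (i == qj j * m)%N then c j else 0.
    case: (r == rj j) => //; rewrite sg_cstM sg_XnE andTb.
    by case: eqP; rewrite ?mulr1 ?mulr0.
  rewrite /= /tail; have [/dvdnP[t ti]|mi] /= := boolP (m %| i)%N; last first.
    rewrite add0r; case: (i =P (qj j * m)%N) mi => [->|]; first by rewrite dvdn_mull.
    by rewrite andbF.
  rewrite ti eqn_pmul2r // -ti.
  have wE : w r i = (v r + t * e)%N by rewrite /w ti mulnK.
  case: (ltngtP j (w r i)) => jw /=.
  - case: eqP => [rE|]; rewrite /= ?addr0 //; case: eqP => [tE|]; rewrite /= ?addr0 //.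
    have [->|cj] := eqVneq (c j) 0; rewrite ?addr0 //.
    have [UGj Gj] := GP j; have [_ jq] := jE j Gj UGj cj.
    by move: jw; rewrite wE tE rE addnC -jq ltnn.
  - rewrite add0r; case: eqP => [rE|] //=; case: eqP => [tE|] //=.
    have [->|cj] // := eqVneq (c j) 0.
    have [UGj Gj] := GP j; have [_ jq] := jE j Gj UGj cj.
    by move: jw; rewrite wE tE rE addnC -jq ltnn.
  have rE : r = rj j.
    apply: val_inj => /=; rewrite jw wE addnC modnMDl.
    by case: (fvP r).
  by rewrite -jw add0r -rE eqxx /qj -rE jw wE addKn mulnK // eqxx.
(* The remainder at stage [j] minus all that is still to be subtracted does not depend on [j]; its
   order is at least every [j], so it is zero. *)
pose h j := G j - \sum_r T j r *: f r.
have hS j : h j.+1 = h j.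
  rewrite /h [in RHS](eq_bigr (fun r => T j.+1 r *: f r +
    (if r == rj j then (sg_cst (c j) * X ^+ qj j) *: f r else 0))); last first.
    by move=> r _; rewrite TS scalerDl; case: ifP => //; rewrite scale0r.
  rewrite big_split /= -big_mkcond big_pred1_eq /= -/(c j).
  by rewrite [\sum_r _ + _]addrC opprD addrA.
have h_leads j : leads (h j) j.
  have [_ Gj] := GP j; move=> i ij; rewrite interleaveB Gj // /cf summxE sg_sumE.
  rewrite big1 ?subrr // => r _; rewrite mxE sg_mulE big1 // => -[s s_le] _ /=.
  rewrite /tail; case: ifP => [/andP[/dvdnP[t st] jw]|_]; last by rewrite mul0r.
  have [_ fv _ _] := fvP r.
  suff -> : f r 0 (inord (i %% p)) (i %/ p - s)%N = 0 by rewrite mulr0.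
  have si : (s * p <= i)%N by rewrite -leq_divRL.
  have /fv : (i - s * p < v r)%N.
    have wE : (s * p + v r = w r s)%N by rewrite /w st mulnK // mulnA addnC.
    by rewrite ltn_subLR // wE (leq_trans ij).
  rewrite -{2 3}(subnKC si) modnMDl divnMDl // addKn.
  exact.
have h0 : h 0%N = 0.
  apply: interleave_eq0 => i; suff <- : h i.+1 = h 0%N by exact: h_leads.
  by elim: i.+1 => [|j <-]; [exact: erefl | exact: hS].
exists (T 0%N); apply/eqP; rewrite -subr_eq0; apply/eqP; exact: h0.
Qed.

End Noetherian.

Lemma sgring_noetherian p (U : submodule 'rV[R]_p) : submodule_generated U.
Proof.
case: p U => [|p'] U; last exact: sgring_submodule_generated.
exists 0%N, (fun=> 0); split=> [i|x _]; first exact: submod0.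
by exists (fun=> 0); rewrite big_ord0 [x]thinmx0.
Qed.
End SemigroupRing.

(** * Coordinates of [R] over [A] *)

Section Coordinates.
Variables (k : fieldType) (H : natSubmonoid) (n' m : nat).
Local Notation n := n'.+1.
Hypothesis Hm : H m.
Hypothesis coprime_mn : coprime n m.
Local Notation S := (glue_semigroup n H m).
Local Notation A := (sgring k H).
Local Notation R := (sgring k S).
Local Notation phi := (sg_expand k H n m).

Lemma glue_gen : S m.
Proof. by exists 0%N, 1%N; split; [exact: sm0 | rewrite muln0 mul1n]. Qed.

Local Notation X := (sg_Xn k glue_gen : R).

Lemma dvd_diff i c : (i < n)%N -> (n %| m * (i - c))%N -> (i <= c)%N.
Proof.
move=> i_n; rewrite Gauss_dvdr // => /dvdn_leq; case: (leqP i c) => // ci.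
by rewrite subn_gt0 => /(_ ci); rewrite leqNgt (leq_ltn_trans (leq_subr _ _)).
Qed.

(** Coprimality gives [c = i] modulo [n], and [n * q] copies of [m] amount to [n] times [q * m].
    Since [m] lies in [H], so does [x] whenever [h] does. *)
Lemma glue_normal_form h i c x : (i < n)%N ->
  (n * x + m * i = n * h + c * m)%N -> exists q, c = (i + n * q)%N /\ x = (h + q * m)%N.
Proof.
move=> i_n E; have ic : (i <= c)%N.
  apply: (dvd_diff i_n); case: (leqP i c) => [|ci].
    by rewrite -subn_eq0 => /eqP->; rewrite muln0 dvdn0.
  rewrite -(dvdn_addr _ (dvdn_mulr x (dvdnn n))) mulnBr addnBA; last first.
    by rewrite leq_mul2l (ltnW ci) orbT.
  by rewrite E [(m * c)%N]mulnC addnK dvdn_mulr.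
have /dvdnP[q qE] : (n %| c - i)%N.
  rewrite -(Gauss_dvdr _ coprime_mn) -(dvdn_addr _ (dvdn_mulr h (dvdnn n))).
  by rewrite mulnBr addnBA ?leq_mul2l ?ic ?orbT // [(m * c)%N]mulnC -E addnK dvdn_mulr.
exists q; have cE : c = (i + n * q)%N by rewrite [(n * q)%N]mulnC -qE subnKC.
split=> //; apply/eqP; rewrite -(eqn_pmul2l (ltn0Sn n')) -(eqn_add2r (m * i)) E cE.
by apply/eqP; ring.
Qed.

(** Reducing [i] modulo [n] keeps the support inside [H] for every natural number [i]. *)
Definition co (i : nat) (r : R) : A.
Proof.
refine (@sgring_of k H (fun h => r (n * h + m * (i %% n))%N) _) => x rx.
have /sgring_predP /(_ _ rx)[h [c [Hh E]]] := sgringP r.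
have [q [_ ->]] := glue_normal_form (ltn_pmod i (ltn0Sn n')) E.
by apply: smD => //; exact: sm_mul.
Defined.

Lemma coE i r h : (i < n)%N -> co i r h = r (n * h + m * i)%N.
Proof. by move=> i_n; rewrite /= modn_small. Qed.

(** Only the term [j = i] reaches this exponent, by uniqueness of the normal form. *)
Lemma coef_sum_phi (c : 'I_n -> A) (i : 'I_n) h :
  (\sum_(j < n) phi (c j) * X ^+ j) (n * h + m * i)%N = c i h.
Proof.
have term (j : 'I_n) s : (phi (c j) * X ^+ j) s = if (j * m <= s)%N
    then if (n %| s - j * m)%N then c j ((s - j * m) %/ n)%N else 0 else 0.
  by rewrite mulrC sg_XnM.
rewrite sg_sumE (bigD1 i) // term [(m * i)%N]mulnC leq_addl addnK.
rewrite dvdn_mulr // mulKn // big1 => [|j ji]; first exact: addr0.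
rewrite term; case: leqP => // jm; case: ifP => // dvd.
case/eqP: ji; apply: val_inj => /=.
have E : (n * h + m * i = n * ((n * h + i * m - j * m) %/ n) + j * m)%N.
  by rewrite [(n * (_ %/ _))%N]mulnC divnK // subnK // [(m * i)%N]mulnC.
have [q [jE _]] := glue_normal_form (ltn_ord i) E.
case: q jE => [|q]; first by rewrite muln0 addn0.
move=> jE; have := ltn_ord j; rewrite jE mulnS.
by rewrite ltnNge addnCA leq_addr.
Qed.

Lemma co_sum_phi (c : 'I_n -> A) (i : 'I_n) : co i (\sum_(j < n) phi (c j) * X ^+ j) = c i.
Proof. by apply: sgringE => h; rewrite coE // coef_sum_phi. Qed.

Lemma sum_co r : r = \sum_(i < n) phi (co i r) * X ^+ i.
Proof.
apply: sgringE => s; have [[h [c [Hh sE]]]|nS] := pselect (S s); last first.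
  by rewrite !sgring_notin.
pose i : 'I_n := Ordinal (ltn_pmod c (ltn0Sn n')).
have {}sE : s = (n * (h + c %/ n * m) + m * i)%N.
  by rewrite sE {1}(divn_eq c n) /=; ring.
by rewrite sE coef_sum_phi coE.
Qed.

Lemma co_mod i r : co i r = co (i %% n) r.
Proof. by apply: sgringE => h; rewrite /= modn_mod. Qed.

Lemma co_linear i (a : A) (r s : R) : co i (phi a * r + s) = a * co i r + co i s.
Proof.
rewrite !(co_mod i); pose j : 'I_n := Ordinal (ltn_pmod i (ltn0Sn n')).
rewrite -[(i %% n)%N]/(val j) -(co_sum_phi (fun j => a * co j r + co j s)).
congr (co j _); rewrite {1}[r]sum_co {1}[s]sum_co mulr_sumr -big_split.
by apply: eq_bigr => l _; rewrite /= rmorphD rmorphM mulrDl mulrA.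
Qed.

Lemma co_Xn i j : (i < n)%N -> (j < n)%N -> co i (X ^+ j) = (i == j)%:R.
Proof.
move=> i_n j_n; rewrite -[i]/(val (Ordinal i_n)).
rewrite -(co_sum_phi (fun l => (val l == j)%:R)); congr co.
rewrite (bigD1 (Ordinal j_n)) //= eqxx rmorph1 mul1r big1 ?addr0 // => l lj.
by rewrite -[j]/(val (Ordinal j_n)) (inj_eq val_inj) (negPf lj) rmorph0 mul0r.
Qed.

Lemma phi_Xn : phi (sg_Xn k Hm) = X ^+ n.
Proof.
apply: sgringE => i; rewrite sg_XnE /=; case: ifP => [/dvdnP[q ->]|ni].
  by rewrite mulnK // mulnC eqn_pmul2l.
by case: eqP ni => // ->; rewrite dvdn_mulr.
Qed.

End Coordinates.

(** * The isomorphism with the quotient of the polynomial ring *)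

Section Isomorphism.
Import Pdiv.CommonRing Pdiv.RingMonic.
Variables (k : fieldType) (H : natSubmonoid) (n' m : nat).
Local Notation n := n'.+1.
Hypothesis Hm : H m.
Hypothesis coprime_mn : coprime n m.
Local Notation A := (sgring k H).
Local Notation R := (sgring k (glue_semigroup n H m)).
Local Notation phi := (sg_expand k H n m).
Local Notation X := (sg_Xn k (glue_gen H n' m) : R).
Local Notation q := ('X^n - (sg_Xn k Hm)%:P : {poly A}).
Local Notation co := (co Hm coprime_mn).

Definition poly_eval : {rmorphism {poly A} -> R} :=
  horner_morph (fun a : A => mulrC (X : R) (phi a)).

Lemma poly_eval_small (p : {poly A}) : (size p <= n)%N ->
  poly_eval p = \sum_(i < n) phi p`_i * X ^+ i.
Proof.
move=> pn; rewrite /= /horner_morph (@horner_coef_wide _ n).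
  by apply: eq_bigr => i _; rewrite coef_map.
exact: leq_trans (size_poly _ _) pn.
Qed.

(** Evaluation kills [q], so only the remainder modulo [q] matters; its degree is below [n], and
    [co] recovers its coefficients from its value. *)
Lemma poly_eval_eq0 p : poly_eval p = 0 -> in_qpoly q p = 0.
Proof.
have q_eval : poly_eval q = 0.
  have evX : poly_eval 'X = X := horner_morphX _.
  have evC : poly_eval (sg_Xn k Hm)%:P = phi (sg_Xn k Hm) := horner_morphC _ _.
  by rewrite rmorphB rmorphXn evX evC phi_Xn subrr.
move=> p0; apply: val_inj; rewrite /= mk_monic_XnsubC //.
have qm : q \is monic by exact: monicXnsubC.
set p' := rmodp _ _; have sp' : (size p' <= n)%N.
  by rewrite -ltnS -(size_XnsubC (sg_Xn k Hm) (ltn0Sn n')) ltn_rmodp monic_neq0.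
have : poly_eval p' = 0.
  move: p0; rewrite (rdivp_eq qm p) rmorphD rmorphM q_eval mulr0 add0r; exact.
rewrite poly_eval_small // => p'0; apply/polyP => i; rewrite coef0.
case: (ltnP i n) => [i_n|ni]; last by rewrite nth_default // (leq_trans sp').
have := co_sum_phi Hm coprime_mn (fun i : 'I_n => p'`_i) (Ordinal i_n).
by rewrite p'0 /= => <-; exact: sgringE.
Qed.

Lemma poly_eval_inj p1 p2 :
  poly_eval p1 = poly_eval p2 -> in_qpoly q p1 = in_qpoly q p2.
Proof.
move=> p12; apply/eqP; rewrite -subr_eq0 -rmorphB; apply/eqP/poly_eval_eq0.
by rewrite rmorphB p12 subrr.
Qed.

Definition co_poly (r : R) : {poly A} := \poly_(i < n) co i r.

Lemma co_polyK r : poly_eval (co_poly r) = r.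
Proof.
rewrite poly_eval_small ?size_poly // [RHS](sum_co Hm coprime_mn).
by apply: eq_bigr => i _; rewrite coef_poly ltn_ord.
Qed.

(** It respects the ring operations because [poly_eval] does, is injective modulo [q], and sends
    [co_poly r] back to [r]. *)
Definition to_qpoly (r : R) : {poly %/ q} := in_qpoly q (co_poly r).

Fact to_qpoly_is_zmod_morphism : zmod_morphism to_qpoly.
Proof.
by move=> r s; rewrite -rmorphB; apply: poly_eval_inj; rewrite rmorphB !co_polyK.
Qed.

Fact to_qpoly_is_monoid_morphism : monoid_morphism to_qpoly.
Proof.
split=> [|r s]; first rewrite -(in_qpoly1 q).
  by apply: poly_eval_inj; rewrite rmorph1 co_polyK.
by rewrite -rmorphM; apply: poly_eval_inj; rewrite rmorphM !co_polyK.
Qed.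

Definition qpoly_iso : {rmorphism R -> {poly %/ q}} := HB.pack to_qpoly
  (GRing.isZmodMorphism.Build _ _ to_qpoly to_qpoly_is_zmod_morphism)
  (GRing.isMonoidMorphism.Build _ _ to_qpoly to_qpoly_is_monoid_morphism).

Lemma qpoly_iso_bijective : bijective qpoly_iso.
Proof.
have size_q : size (mk_monic q) = n.+1 by rewrite mk_monic_XnsubC ?size_XnsubC.
have inK (x : {poly %/ q}) : in_qpoly q x = x.
  by apply: val_inj; apply: in_qpoly_small; exact: size_mk_monic.
exists (fun x : {poly %/ q} => poly_eval x) => [r|x].
  have -> : qpoly_iso r = co_poly r :> {poly A}.
    by apply: in_qpoly_small; rewrite size_q ltnS size_poly.
  exact: co_polyK.
by rewrite -[RHS]inK; apply: poly_eval_inj; rewrite co_polyK.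
Qed.

Lemma free_restrict : free_of_rank n (restrict phi : lmodType A).
Proof.
exists (fun i : 'I_n => X ^+ i) => r; exists [ffun i : 'I_n => co i r]; split.
  by rewrite [LHS](sum_co Hm coprime_mn); apply: eq_bigr => i _; rewrite ffunE.
move=> c rE; apply/ffunP => i.
by rewrite ffunE -(co_sum_phi Hm coprime_mn c i) rE.
Qed.

Lemma SAC_glue : (0 < m)%N -> SAC A -> SAC R.
Proof.
move=> m_gt0; apply: (SAC_extension (co_linear Hm coprime_mn)
  (co_Xn k Hm coprime_mn) (sum_co Hm coprime_mn) (phi_Xn k n' Hm)).
- move=> p U; exact: (sgring_noetherian (glue_gen H n' m) m_gt0).
- exact: sg_X_reg.
- exact: (sgring_complete (glue_gen H n' m) m_gt0).
- exact (@sgring_separated k _ m (glue_gen H n' m) m_gt0).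
Qed.

End Isomorphism.

Lemma natSubmonoid_ext (S T : natSubmonoid) : (forall x, S x <-> T x) -> S = T.
Proof.
case: S T => [S S0 SD] [T T0 TD] /= ST.
have {ST} ST : S = T by apply: funext => x; apply: propext.
by rewrite {S}ST in S0 SD *; congr NatSubmonoid; exact: Prop_irrelevance.
Qed.

Lemma glue_semigroup1 (H : natSubmonoid) m : H m -> glue_semigroup 1 H m = H.
Proof.
move=> Hm; apply: natSubmonoid_ext => x; split=> [[h [c [Hh ->]]]|Hx].
  by rewrite mul1n; apply: smD => //; exact: sm_mul.
by exists x, 0%N; rewrite mul1n addn0.
Qed.

Theorem proposition5p2 (k : fieldType) (l : nat) (a : 'I_l -> nat) (m n : nat)
    (a_gt0 : forall i, (0 < a i)%N)
    (H_num : numerical_semigroup (gen_semigroup a))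
    (coprime_mn : gcdn m n = 1%N)
    (m_in_H : gen_semigroup a m)
    (m_neq_a : forall i, m <> a i) :
  let H := gen_semigroup a in
  let S := glue_semigroup n H m in
  let A := sgring k H in
  let R := sgring k S in
  let tm : A := sg_Xn k m_in_H in
  [/\ (exists phi : {rmorphism R -> {poly %/ ('X^n - tm%:P : {poly A})}},
         bijective phi),
      free_of_rank n (restrict (sg_expand k H n m) : lmodType A)
    & SAC A -> SAC R].
Proof.
(* [n = 0] would force [m = 1], which lies in [H] only as one of the generators. *)
have := glue_exponent_gt0 coprime_mn m_in_H m_neq_a.
case: n coprime_mn => [//|n'] gcd_mn _ H S A R tm.
have cop : coprime n'.+1 m by rewrite coprime_sym; apply/eqP.
split.
- by exists (qpoly_iso k m_in_H cop); exact: qpoly_iso_bijective.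
- exact: free_restrict m_in_H cop.
(* For [m = 0] the element [X] is 1 and separation fails, so this case is treated apart. *)
have [m0|m_gt0] := posnP m; last exact: SAC_glue m_in_H cop m_gt0.
have n'0 : n' = 0%N by move: gcd_mn; rewrite m0 gcd0n => -[].
by rewrite /R /S n'0 glue_semigroup1.
Qed.
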